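(* Fix $r,q\in\mathbb N$. Consider the Cauchy problems $$\dot a_i=a_i\Big(\prod_{j=1}^{r}a_{i+j}-\prod_{j=1}^{r}a_{i-j}\Big),\qquad \dot b_i=b_i\Big(\sum_{j=1}^{q}b_{i+j}-\sum_{j=1}^{q}b_{i-j}\Big),\qquad i\in\mathbb Z_+,$$ with $a_l=b_l=0$ for $l<0$, in the class of solutions with $a_i(t),b_i(t)\in\mathbb C\setminus\{0\}$ and $(a_i(t))_{i\ge0},(b_i(t))_{i\ge0}\in l_\infty$ for each $t$. For any initial data $(a_i(0))_{i\ge0},(b_i(0))_{i\ge0}\in l_\infty$ with all $a_i(0),b_i(0)\neq0$, there exists $\delta>0$ such that both Cauchy problems have unique solutions on $t\in[0,\delta)$, and these solutions are obtained as follows. Let $L1(0)$ and $L2(0)$ be the matrices built from the initial data (see context) and compute the initial moments $S^{m,1}_k(0)=(L1(0)^k)_{m-1,0}$ ($m=1,\dots,r$) and $S^{1,n}_k(0)=(L2(0)^k)_{0,n-1}$ ($n=1,\dots,q$). For $t\in[0,\delta)$ and $k\ge 0$ set $$S^{m,1}_k(t)=\frac{\sum_{l=0}^\infty S^{m,1}_{k+(r+1)l}(0)\,t^l/l!}{\sum_{l=0}^\infty S^{1,1}_{(r+1)l}(0)\,t^l/l!},\qquad S^{1,n}_k(t)=\frac{\sum_{l=0}^\infty S^{1,n}_{k+(q+1)l}(0)\,t^l/l!}{\sum_{l=0}^\infty S^{1,n}_{n-1+(q+1)l}(0)\,t^l/l!}.$$ Form $\Delta^{(1)}_k(t)=\det(\alpha_{i,j}(t))_{i,j=0}^k$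 with $\alpha_{i,j}(t)=S^{\operatorname{rem}(i,r)+1,\,1}_{\lfloor i/r\rfloor+j}(t)$, and $\Delta^{(2)}_k(t)=\det(\beta_{i,j}(t))_{i,j=0}^k$ with $\beta_{i,j}(t)=S^{1,\,\operatorname{rem}(j,q)+1}_{i+\lfloor j/q\rfloor}(t)$, with $\Delta^{(1)}_{-1}=\Delta^{(2)}_{-1}=1$. Then for all $i\ge 0$ and $t\in[0,\delta)$, $$a_i(t)=\frac{\Delta^{(1)}_{i+1}(t)\Delta^{(1)}_{i-1}(t)}{\Delta^{(1)}_i(t)^2},\qquad b_i(t)=\frac{\Delta^{(2)}_{i+q}(t)\Delta^{(2)}_{i-1}(t)}{\Delta^{(2)}_{i+q-1}(t)\Delta^{(2)}_i(t)}.$$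
   Context: For a sequence $(a_i)$, $L1$ is the infinite matrix (indices $\ge 0$) with $(L1)_{i,i+r}=1$, $(L1)_{i+1,i}=a_i$ for $i\ge 0$ and all other entries zero; for $(b_i)$, $L2$ is the infinite matrix with $(L2)_{i,i+1}=1$, $(L2)_{i+q,i}=b_i$ for $i\ge0$ and all other entries zero. $\operatorname{rem}(a,b)$ is the remainder of $a$ modulo $b$; matrix powers are ordinary products of banded matrices. *)

(* Defs.v *)
From HB Require Import structures.
From mathcomp Require Import all_boot all_order all_algebra.
From mathcomp Require Import complex.
From mathcomp Require Import all_classical all_reals all_analysis.
Set Implicit Arguments. Unset Strict Implicit. Unset Printing Implicit Defensive.
Import Order.TTheory GRing.Theory Num.Theory.
Import numFieldNormedType.Exports.
Local Open Scope classical_set_scope.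
Local Open Scope ring_scope.
Local Open Scope complex_scope.

Section Defs.
Variable R : realType.
Local Notation C := R[i].
(* R[i] viewed as a numFieldType, to get its (norm) topology from
   MathComp-Analysis *)
Local Notation CC := (R[i] : numFieldType).

Definition infmx := nat -> nat -> C.

Definition infmx1 : infmx := fun i j => if i == j then 1 else 0.

(* Product A * B of infinite matrices when column j of B vanishes at all rows
   l >= cb j : then (A B)_{ij} = sum_l A_{il} B_{lj} is the finite sum below. *)
Definition infmx_mul (cb : nat -> nat) (A B : infmx) : infmx :=
  fun i j => \sum_(l < cb j) A i l * B l j.

Fixpoint infmx_pow (cb : nat -> nat) (L : infmx) (k : nat) : infmx :=
  match k with
  | 0 => infmx1
  | k'.+1 => infmx_mul cb (infmx_pow cb L k') L
  end.

Definition L1 (r : nat) (a : nat -> C) : infmx :=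
  fun i j => if j == i + r then 1 else if i == j.+1 then a j else 0.
(* column j of L1 is supported in rows {j - r, j + 1}, i.e. rows < j + 2 *)
Definition L1_colbound (r : nat) : nat -> nat := fun j => j.+2.

Definition L2 (q : nat) (b : nat -> C) : infmx :=
  fun i j => if j == i.+1 then 1 else if i == j + q then b j else 0.
(* column j of L2 is supported in rows {j - 1, j + q}, i.e. rows < j + q + 1 *)
Definition L2_colbound (q : nat) : nat -> nat := fun j => (j + q).+1.

Definition S1_0 (r : nat) (a0 : nat -> C) (m k : nat) : C :=
  infmx_pow (L1_colbound r) (L1 r a0) k m.-1 0.
Definition S2_0 (q : nat) (b0 : nat -> C) (n k : nat) : C :=
  infmx_pow (L2_colbound q) (L2 q b0) k 0 n.-1.

Definition expser (u : nat -> C) (t : R) : C :=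
  limn (series (fun l => u l * (t%:C) ^+ l / (l`!)%:R : CC)).

Definition S1_t (r : nat) (a0 : nat -> C) (m k : nat) (t : R) : C :=
  expser (fun l => S1_0 r a0 m (k + r.+1 * l)) t /
  expser (fun l => S1_0 r a0 1 (r.+1 * l)) t.

Definition S2_t (q : nat) (b0 : nat -> C) (n k : nat) (t : R) : C :=
  expser (fun l => S2_0 q b0 n (k + q.+1 * l)) t /
  expser (fun l => S2_0 q b0 n (n.-1 + q.+1 * l)) t.

(* D1 n t = Delta^{(1)}_{n-1}(t) = det (alpha_{i,j}(t))_{i,j=0}^{n-1};
   D1 0 t = 1 = Delta^{(1)}_{-1} (determinant of the empty matrix). *)
Definition D1 (r : nat) (a0 : nat -> C) (n : nat) (t : R) : C :=
  \det (\matrix_(i < n, j < n) S1_t r a0 ((i %% r).+1) (i %/ r + j) t).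

Definition D2 (q : nat) (b0 : nat -> C) (n : nat) (t : R) : C :=
  \det (\matrix_(i < n, j < n) S2_t q b0 ((j %% q).+1) (i + j %/ q) t).

Definition linfty (u : nat -> C) : Prop :=
  exists M : R, forall i, `|u i| <= M%:C.

(* f has derivative l at t relative to the interval [0, delta):
   one-sided (right) derivative at t = 0, ordinary derivative for t > 0. *)
Definition has_deriv_on0 (f : R -> C) (t : R) (l : C) : Prop :=
  if t == 0 then
    (fun h : R => (h%:C)^-1 * (f (t + h) - f t) : CC) @ 0^'+ --> (l : CC)
  else
    (fun h : R => (h%:C)^-1 * (f (t + h) - f t) : CC) @ 0^' --> (l : CC).

(* right-hand sides, with a_l = b_l = 0 for l < 0 *)
Definition rhsA (r : nat) (a : nat -> C) (i : nat) : C :=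
  a i * (\prod_(1 <= j < r.+1) a (i + j)%N
         - \prod_(1 <= j < r.+1) (if (j <= i)%N then a (i - j)%N else 0)).

Definition rhsB (q : nat) (b : nat -> C) (i : nat) : C :=
  b i * (\sum_(1 <= j < q.+1) b (i + j)%N
         - \sum_(1 <= j < q.+1) (if (j <= i)%N then b (i - j)%N else 0)).

Definition is_solution (rhs : (nat -> C) -> nat -> C) (delta : R)
    (u0 : nat -> C) (u : R -> nat -> C) : Prop :=
  u 0 = u0 /\
  forall t, 0 <= t < delta ->
    linfty (u t) /\
    (forall i, u t i != 0) /\
    (forall i, has_deriv_on0 (fun s => u s i) t (rhs (u t) i)).

End Defs.

(* Main.v *)
(* Uniqueness and the formula.  For any solution, the moments s_k (entries of
   the powers of L(t)) satisfy s_k' = s_{k+p} - g s_k with p = r + 1 (resp.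
   q + 1).  With an integrating factor tau' = g tau, the functions
   tau s_{k+pl}, l >= 0, are the successive derivatives of tau s_k, and since
   (a_i(t)) is bounded for each t they grow at most geometrically in l at each
   t.  No uniformity in t is assumed, but by the Pringsheim-Boas argument (a
   nested-interval form of Baire's theorem) tau s_k is then the sum of its
   Taylor series at 0; dividing by tau gives the stated moments.  The matrix of
   moments factors as (unit lower triangular) * (upper triangular with products
   of the a_i, resp. b_i, on the diagonal), which yields the determinants.

   Existence.  The Picard iterates are polynomials in t and converge uniformly;
   a solution of u' = u G does not vanish because an integrating factor makes
   it constant. *)
Require Import Defs.
From HB Require Import structures.
From mathcomp Require Import all_boot all_order all_algebra.
From mathcomp Require Import complex ring lra zify.
From mathcomp Require Import all_classical all_reals all_analysis.
Import Order.TTheory GRing.Theory Num.Theory.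
Import numFieldNormedType.Exports Normc.
Local Open Scope classical_set_scope.
Local Open Scope ring_scope.
Local Open Scope complex_scope.
Set Implicit Arguments.
Unset Strict Implicit.
Unset Printing Implicit Defensive.

(** * Functions equal to their Taylor series *)

(** Origin of the moment equation: each system is a Lax equation L' = LA - AL, with A the strictly
    lower triangular part of L^p. The entries of L^p lie on diagonals whose offsets are multiples of
    p, so the rows of A of index below p vanish, and in such a row the derivative of L^k is L^k A.
    In the columns used, L^k A differs from L^(k+p) only by the diagonal of L^p; the corresponding
    diagonal entry is g. The computation below follows the recursion on k entry by entry.

    The obstacle is that g involves the unknown solution. Two families of moments with the same g
    are therefore compared, and one member of the second is identically 1; its series is the
    integrating factor itself and serves as denominator.

    Two features shape the analysis. At time 0 only a right derivative is given, so intervals are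
    closed by continuity alone. Taylor and mean value estimates are real, so complex functions are
    split into real and imaginary parts. The formula holds on any interval carrying a solution;
    [delta] comes only from existence. *)

Lemma is_derive_taylor (R : realType) (f : nat -> R -> R) (t s : R) (N : nat) :
  (forall k, is_derive s 1 (f k) (f k.+1 s)) ->
  is_derive s 1 (fun x => \sum_(l < N.+1) f l x * (t - x) ^+ l / l`!%:R)
    (f N.+1 s * (t - s) ^+ N / N`!%:R).
Proof.
move=> df; elim: N => [|N IH].
  have -> : (fun x => \sum_(l < 1) f l x * (t - x) ^+ l / l`!%:R) = f 0%N.
    by apply/funext => x; rewrite big_ord1 /= expr0 fact0 divr1 mulr1.
  by rewrite expr0 fact0 divr1 mulr1.
have -> : (fun x => \sum_(l < N.+2) f l x * (t - x) ^+ l / l`!%:R) =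
  (fun x => \sum_(l < N.+1) f l x * (t - x) ^+ l / l`!%:R) +
  f N.+1 * (fun x => (t - x) ^+ N.+1 / N.+1`!%:R).
  by apply/funext => x; rewrite big_ord_recr /= !fctE mulrA.
have dp : is_derive s 1 (fun x => (t - x) ^+ N.+1 / N.+1`!%:R : R)
  (- (t - s) ^+ N / N`!%:R).
  have -> : (fun x => (t - x) ^+ N.+1 / N.+1`!%:R : R) =
    (N.+1`!%:R)^-1 *: ((cst t - id) ^+ N.+1).
    by apply/funext => x; rewrite !fctE mulrC.
  apply: is_derive_eq.
  have h1 : N.+1%:R != 0 :> R by rewrite pnatr_eq0.
  have h2 : N`!%:R != 0 :> R by rewrite pnatr_eq0 -lt0n fact_gt0.
  rewrite sub0r /GRing.scale /= !fctE factS natrM.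
  by field; rewrite h2 nat1r h1.
apply: is_derive_eq.
rewrite /GRing.scale /= factS natrM.
have h1 : N.+1%:R != 0 :> R by rewrite pnatr_eq0.
have h2 : N`!%:R != 0 :> R by rewrite pnatr_eq0 -lt0n fact_gt0.
by field; rewrite h2 nat1r h1.
Qed.

(** End points carry continuity only: the solutions have just a right derivative at time 0. *)
Definition derivative_tower (R : realType) (f : nat -> R -> R) (x y : R) :=
  forall k, {within `[x, y], continuous (f k)} /\
    forall z, x < z < y -> is_derive z 1 (f k) (f k.+1 z).

Lemma derivative_tower_sub (R : realType) (f : nat -> R -> R) (x y x' y' : R) :
  x <= x' -> y' <= y -> derivative_tower f x y -> derivative_tower f x' y'.
Proof.
move=> xx' yy' ft k; have [fc fd] := ft k; split.
  apply: continuous_subspaceW fc => z /=; rewrite !in_itv /= => /andP[? ?].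
  by apply/andP; split; lra.
by move=> z /andP[? ?]; apply: fd; apply/andP; split; lra.
Qed.

(** Let the centre [s] of the Taylor polynomial move while [t] is fixed: the derivative in [s]
    telescopes to a single term, and the mean value theorem between [s = c] and [s = t] gives
    Cauchy's form of the remainder. Hence the factorial of [N] rather than of [N.+1]. *)
Lemma taylor_remainder (R : realType) (f : nat -> R -> R) (x y c t B : R) (N : nat) :
  derivative_tower f x y -> x <= c <= y -> x <= t <= y ->
  (forall s, x <= s <= y -> `|f N.+1 s| <= B) ->
  `|f 0%N t - \sum_(l < N.+1) f l c * (t - c) ^+ l / l`!%:R|
    <= B * `|t - c| ^+ N.+1 / N`!%:R.
Proof.
move=> ft cxy txy fB.
pose phi s := \sum_(l < N.+1) f l s * (t - s) ^+ l / l`!%:R.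
have phit : phi t = f 0%N t.
  rewrite /phi big_ord_recl /= expr0 fact0 divr1 mulr1 big1 ?addr0// => i _.
  by rewrite subrr /bump /= expr0n mulr0 mul0r.
rewrite -phit -/(phi c).
have mvt u v : x <= u -> u <= v -> v <= y ->
    exists2 s, u <= s <= v & phi v - phi u = f N.+1 s * (t - s) ^+ N / N`!%:R * (v - u).
  move=> xu uv vy.
  have ft' := derivative_tower_sub xu vy ft.
  have [| |s suv e] := @MVT_segment R phi
      (fun s => f N.+1 s * (t - s) ^+ N / N`!%:R) u v uv.
  - move=> z; rewrite in_itv /= => zuv; apply: is_derive_taylor => k.
    by have [_] := ft' k; apply.
  - rewrite /phi; elim: N.+1 => [|n IHn].
      have -> : (fun s => \sum_(l < 0) f l s * (t - s) ^+ l / l`!%:R) = cst 0.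
        by apply/funext => s; rewrite big_ord0.
      by move=> z; exact: cvg_cst.
    have -> : (fun s => \sum_(l < n.+1) f l s * (t - s) ^+ l / l`!%:R) =
      (fun s => \sum_(l < n) f l s * (t - s) ^+ l / l`!%:R +
         f n s * ((t - s) ^+ n / n`!%:R)).
      by apply/funext => s; rewrite big_ord_recr /= mulrA.
    move=> z; apply: cvgD; first exact: IHn.
    apply: cvgM; first by have [h _] := ft' n; exact: h.
    apply: cvgMr_tmp => /=.
    apply: (@continuous_subspaceT _ _ _ (fun s : R => (t - s) ^+ n)).
    move=> w; apply: (@continuous_comp _ _ _ (fun s : R => t - s) (fun s : R => s ^+ n)).
      by apply: cvgB; [exact: cvg_cst|exact: cvg_id].
    exact: exprn_continuous.
  - by exists s.
have bnd u v s : x <= u -> v <= y -> u <= s <= v -> `|t - s| <= `|t - c| ->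
    v - u = `|t - c| ->
    `|f N.+1 s * (t - s) ^+ N / N`!%:R * (v - u)| <= B * `|t - c| ^+ N.+1 / N`!%:R.
  move=> xu vy /andP[us sv] ts ->.
  rewrite !normrM normr_id normfV normrX (@normr_nat R).
  have fNB : `|f N.+1 s| <= B by apply: fB; apply/andP; split; lra.
  rewrite [leLHS]mulrAC ler_wpM2r ?invr_ge0 ?ler0n// exprSr mulrA ler_wpM2r//.
  by rewrite ler_pM ?exprn_ge0// lerXn2r ?nnegrE.
have [ct|tc] := leP c t.
  have [||//|s st ->] := mvt c t _ _ _; [lra|lra|lra|].
  apply: (bnd c t s) => //; [lra|lra| |]; last by rewrite ger0_norm; lra.
  by rewrite !ger0_norm; lra.
have [||//|s st e] := mvt t c _ _ _; [lra|lra|lra|].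
rewrite distrC e.
apply: (bnd t c s) => //; [lra|lra| |]; last by rewrite ltr0_norm; lra.
by rewrite ler0_norm ?ltr0_norm; lra.
Qed.

Lemma exp_partial_sum_le (R : realType) (x : R) (n : nat) :
  0 <= x -> \sum_(l < n) x ^+ l / l`!%:R <= expR x.
Proof.
move=> x0; have h : {homo series (exp_coeff x) : n m / (n <= m)%N >-> n <= m}.
  by apply: nondecreasing_series => k _ _; exact: exp_coeff_ge0.
have := nondecreasing_cvgn_le h (is_cvg_series_exp_coeff x) n.
by rewrite /series /= big_mkord.
Qed.

(** The exponent [k.+1] lets a single constant bound the functions from order 0 on, absorbing any
    prefactor. *)
Definition pointwise_geometric (R : realType) (f : nat -> R -> R) (M s : R) :=
  forall k, `|f k s| <= M ^+ k.+1.

Definition uniformly_geometric (R : realType) (f : nat -> R -> R) (x y : R) :=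
  exists M, forall s, x <= s <= y -> pointwise_geometric f M s.

Lemma pointwise_geometric_ge0 (R : realType) (f : nat -> R -> R) (M s : R) :
  pointwise_geometric f M s -> 0 <= M.
Proof. by move=> /(_ 0%N); apply: le_trans. Qed.

Lemma pointwise_geometricW (R : realType) (f : nat -> R -> R) (M M' s : R) :
  M <= M' -> pointwise_geometric f M s -> pointwise_geometric f M' s.
Proof.
move=> MM' fM k; have M0 := pointwise_geometric_ge0 fM.
by apply: le_trans (fM k) _; rewrite lerXn2r ?nnegrE // (le_trans M0).
Qed.

Lemma derivative_tower_shift (R : realType) (f : nat -> R -> R) (x y : R) k :
  derivative_tower f x y -> derivative_tower (fun l => f (l + k)%N) x y.
Proof. by move=> ft l; have := ft (l + k)%N. Qed.

Lemma taylor_remainder_cvg (R : realType) (f : nat -> R -> R) (x y c t e : R) :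
  derivative_tower f x y -> uniformly_geometric f x y ->
  x <= c <= y -> x <= t <= y -> 0 < e ->
  \forall N \near \oo,
    `|f 0%N t - \sum_(l < N.+1) f l c * (t - c) ^+ l / l`!%:R| <= e.
Proof.
move=> ft [K fK] cxy txy e0.
have K0 := pointwise_geometric_ge0 (fK c cxy).
(* With the bound [K ^+ N.+2] on the derivative of order [N.+1], the remainder estimate is exactly
   this multiple of the general term of an exponential series. *)
have : (fun N => K ^+ 2 * `|t - c| * exp_coeff (K * `|t - c|) N) @ \oo
    --> K ^+ 2 * `|t - c| * 0.
  by apply: cvgMl_tmp; exact: cvg_exp_coeff.
rewrite mulr0 => /cvgrPdist_le /(_ e e0); apply: filterS => N.
rewrite sub0r normrN => h; apply: le_trans (le_trans (ler_norm _) h).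
apply: le_trans (@taylor_remainder _ f x y c t (K ^+ N.+2) N ft cxy txy _) _.
  by move=> s sxy; exact: fK.
rewrite le_eqVlt; apply/orP; left; apply/eqP.
rewrite /exp_coeff /= exprMn !exprS.
by field; rewrite pnatr_eq0 -lt0n fact_gt0.
Qed.

(** Summing the Taylor series of [f k] at [c] bounds it by [M ^+ k.+1] times an exponential. The
    uniform hypothesis only ensures convergence: its constant does not enter the new bound, and this
    independence drives the arguments below. *)
Lemma geometric_transport (R : realType) (f : nat -> R -> R) (x y c t M : R) :
  derivative_tower f x y -> uniformly_geometric f x y ->
  x <= c <= y -> x <= t <= y -> pointwise_geometric f M c ->
  pointwise_geometric f (M * expR (M * (y - x))) t.
Proof.
move=> ft [K fK] cxy txy fM k; have M0 := pointwise_geometric_ge0 fM.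
have K0 := pointwise_geometric_ge0 (fK c cxy).
have tc : `|t - c| <= y - x by rewrite ler_norml; lra.
have yx : 0 <= y - x by apply: le_trans tc.
have E1 : 1 <= expR (M * (y - x)) by apply: le_trans (expR_ge1Dx _); rewrite lerDl mulr_ge0.
suff h : `|f k t| <= M ^+ k.+1 * expR (M * (y - x)).
  apply: le_trans h _; rewrite exprMn ler_wpM2l ?exprn_ge0//.
  by rewrite ler_eXnr.
have [K' fK'] : uniformly_geometric (fun l => f (l + k)%N) x y.
  (* Since l + k + 1 <= (k + 1)(l + 1), the shifted tower is geometric with this power as constant;
     the maximum with 1 makes powers increasing. *)
  exists (Num.max 1 K ^+ k.+1) => s sxy l.
  rewrite -exprM.
  apply: le_trans
    (@pointwise_geometricW _ f K (Num.max 1 K) s _ (fK s sxy) (l + k)%N) _.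
    by rewrite le_max lexx orbT.
  rewrite ler_weXn2l// ?le_max ?lexx//; nia.
apply/ler_addgt0Pr => e e0.
have := taylor_remainder_cvg (derivative_tower_shift k ft)
  (ex_intro _ K' fK') cxy txy e0.
case=> N _ /(_ N (leqnn N)); rewrite /= add0n.
set S := \sum_(l < N.+1) _ => h.
have hS : `|S| <= M ^+ k.+1 * expR (M * (y - x)).
  apply: (@le_trans _ _ (M ^+ k.+1 * \sum_(l < N.+1) (M * (y - x)) ^+ l / l`!%:R)).
    rewrite mulr_sumr; apply: le_trans (ler_norm_sum _ _ _) _.
    apply: ler_sum => l _.
    rewrite !normrM normfV normrX (@normr_nat R) mulrA ler_wpM2r ?invr_ge0 ?ler0n//.
    rewrite exprMn mulrA -exprD ler_pM ?exprn_ge0//.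
      by rewrite addSn addnC; exact: fM.
    by rewrite lerXn2r ?nnegrE.
  by rewrite ler_wpM2l ?exprn_ge0// exp_partial_sum_le// mulr_ge0.
have -> : f k t = f k t - S + S by rewrite subrK.
apply: le_trans (ler_normD _ _) _.
by rewrite addrC lerD.
Qed.

Lemma uniformly_geometric_sub (R : realType) (f : nat -> R -> R) (x y x' y' : R) :
  x <= x' -> y' <= y -> uniformly_geometric f x y -> uniformly_geometric f x' y'.
Proof. by move=> ? ? [M h]; exists M => s ?; apply: h; lra. Qed.

Lemma uniformly_geometric_cat (R : realType) (f : nat -> R -> R) (x y z : R) :
  uniformly_geometric f x y -> uniformly_geometric f y z ->
  uniformly_geometric f x z.
Proof.
move=> [M hM] [K hK]; exists (Num.max M K) => s sxz.
have [sy|ys] := leP s y.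
  by apply: (@pointwise_geometricW _ f M); [rewrite le_max lexx|apply: hM; lra].
by apply: (@pointwise_geometricW _ f K);
  [rewrite le_max lexx orbT|apply: hK; lra].
Qed.

(** The constants on the intervals from [z] to [y] might blow up as [z] tends to [x]; transporting
    the bound [My] from [y] replaces them by one that depends only on [My] and the length. The point
    [x] itself is covered by [Mx]. *)
Lemma uniformly_geometric_closure (R : realType) (f : nat -> R -> R) (x y Mx My : R) :
  derivative_tower f x y ->
  pointwise_geometric f Mx x -> pointwise_geometric f My y ->
  (forall z, x < z < y -> uniformly_geometric f z y) -> uniformly_geometric f x y.
Proof.
move=> ft fx fy fz; have My0 := pointwise_geometric_ge0 fy.
have E1 : 0 <= My * expR (My * (y - x)) by rewrite mulr_ge0 ?expR_ge0.
exists (Mx + My + My * expR (My * (y - x))) => s /andP[].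
have Mx0 := pointwise_geometric_ge0 fx.
rewrite le_eqVlt => /orP[/eqP <- _|xs].
  by apply: pointwise_geometricW fx; lra.
rewrite le_eqVlt => /orP[/eqP ->|sy].
  by apply: pointwise_geometricW fy; lra.
have : pointwise_geometric f (My * expR (My * (y - s))) s.
  apply: (@geometric_transport _ f s y y s) => //; try lra; last by apply: fz; lra.
  by apply: derivative_tower_sub ft; lra.
apply: pointwise_geometricW.
have : My * expR (My * (y - s)) <= My * expR (My * (y - x)).
  by rewrite ler_wpM2l// ler_expR ler_wpM2l//; lra.
lra.
Qed.

(* Otherwise the geometric bound with constant M holds at every point without a
   uniformly geometric neighbourhood; a maximal uniformly geometric interval
   [c, t] starts at [x] or at such a point, whence a uniform bound at t. *)
Lemma bad_subinterval (R : realType) (f : nat -> R -> R) (x y M : R) :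
  x <= y -> derivative_tower f x y ->
  (forall s, x <= s <= y -> exists K, pointwise_geometric f K s) ->
  ~ uniformly_geometric f x y ->
  exists x' y', [/\ x <= x', x' <= y', y' <= y, ~ uniformly_geometric f x' y' &
    exists k, forall s, x' <= s <= y' -> M ^+ k.+1 < `|f k s|].
Proof.
move=> xy ft fp bad; apply: contrapT => none; apply: bad.
(* If the bound failed at such a [c] for some order, continuity would preserve the failure on a
   small interval around [c], which is exactly a subinterval assumed not to exist. *)
have badpt c : x < c < y ->
    (forall e, 0 < e -> x <= c - e -> c + e <= y ->
      ~ uniformly_geometric f (c - e) (c + e)) ->
    pointwise_geometric f M c.
  move=> /andP[xc cy] cbad k; rewrite leNgt; apply/negP => Mf; apply: none.
  have [fc _] := ft k.
  have fcc : {for c, continuous (f k)}.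
    by apply: (within_continuous_continuous (lt_trans xc cy) fc); rewrite in_itv /= xc.
  have : \forall s \near c, M ^+ k.+1 < `|f k s|.
    have : (fun s => `|f k s|) @ c --> `|f k c| by apply: cvg_norm; exact: fcc.
    by move=> /cvgr_gt; apply.
  move=> /nbhs_ballP[d /= d0 hd].
  pose e := Num.min (d / 2) (Num.min (c - x) (y - c)).
  have e0 : 0 < e by rewrite !lt_min; apply/and3P; split; lra.
  have ed : e <= d / 2 by rewrite ge_min lexx.
  have ex : e <= c - x by rewrite !ge_min lexx orbT.
  have ey : e <= y - c by rewrite !ge_min lexx !orbT.
  exists (c - e), (c + e); split; try lra.
    by apply: cbad => //; lra.
  exists k => s sc; apply: hd; rewrite /ball /= ltr_norml; lra.
have [Mx fx] := fp x ltac:(lra); have [My fy] := fp y ltac:(lra).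
have Mx0 := pointwise_geometric_ge0 fx.
pose M' := Num.max M Mx.
have M'0 : 0 <= M' by rewrite le_max Mx0 orbT.
exists (My + M' * expR (M' * (y - x))) => t /andP[xt].
have My0 := pointwise_geometric_ge0 fy.
have E0 : 0 <= M' * expR (M' * (y - x)) by rewrite mulr_ge0 ?expR_ge0.
rewrite le_eqVlt => /orP[/eqP ->|ty].
  by apply: pointwise_geometricW fy; lra.
pose A := [set c | x <= c <= t /\ uniformly_geometric f c t].
have At : A t.
  split; first lra.
  have [Mt ft'] := fp t ltac:(lra).
  by exists Mt => s st; have -> : s = t by lra.
have Alb : lbound A x by move=> c [/andP[]].
pose c := inf A.
have xc : x <= c by apply: lb_le_inf; [exists t|].
have ct : c <= t by apply: ge_inf => //; exists x.
(* The infimum is attained, by the closure lemma. *)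
have gct : uniformly_geometric f c t.
  have [Mc fc] := fp c ltac:(lra); have [Mt ft'] := fp t ltac:(lra).
  apply: (uniformly_geometric_closure _ fc ft').
    by apply: derivative_tower_sub ft; lra.
  move=> z /andP[cz zt].
  have [|w Aw wz] := @inf_adherent _ A (z - c) ltac:(lra).
    by split; [exists t|exists x].
  have [_ gw] := Aw.
  by apply: uniformly_geometric_sub gw; rewrite /c in wz *; lra.
have fc : pointwise_geometric f M' c.
  have [xc'|cx] := ltP x c.
    apply: (@pointwise_geometricW _ f M); first by rewrite le_max lexx.
    apply: badpt; first lra.
    (* A uniformly geometric neighbourhood of [c] would extend the interval to the left of the
       infimum. *)
    move=> e e0 xe ey ge.
    have : A (c - e).
      split; first lra.
      have [cet|tce] := leP (c + e) t.
        apply: (@uniformly_geometric_cat _ f _ c) => //.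
        by apply: uniformly_geometric_sub ge; lra.
      by apply: uniformly_geometric_sub ge; lra.
    move=> /(@ge_inf _ A) h.
    have : c <= c - e by apply: h; exists x.
    lra.
  have -> : c = x by lra.
  by apply: pointwise_geometricW fx; rewrite le_max lexx orbT.
have : pointwise_geometric f (M' * expR (M' * (t - c))) t.
  apply: (@geometric_transport _ f c t c t) => //; try lra.
  by apply: derivative_tower_sub ft; lra.
apply: pointwise_geometricW.
have : M' * expR (M' * (t - c)) <= M' * expR (M' * (y - x)).
  by rewrite ler_wpM2l// ler_expR ler_wpM2l//; lra.
lra.
Qed.

(** Failing intervals are nested so that on [I n.+1] some derivative exceeds the geometric bound
    with constant [n]. A common point of all of them has its own constant [K], which is contradicted
    as soon as [n] exceeds [K]. *)
Lemma tower_uniformly_geometric (R : realType) (f : nat -> R -> R) (x y : R) :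
  x <= y -> derivative_tower f x y ->
  (forall s, x <= s <= y -> exists K, pointwise_geometric f K s) ->
  uniformly_geometric f x y.
Proof.
move=> xy ft fp; apply: contrapT => bad.
pose badI := {p : R * R | [/\ x <= p.1, p.1 <= p.2, p.2 <= y &
  ~ uniformly_geometric f p.1 p.2]}.
have step (I : badI) (n : nat) : {J : badI |
    [/\ (sval I).1 <= (sval J).1, (sval J).2 <= (sval I).2 &
      exists k, forall s, (sval J).1 <= s <= (sval J).2 ->
        n%:R ^+ k.+1 < `|f k s|]}.
  apply: cid; case: I => -[u v] /= [xu uv vy bI].
  have [||u' [v' [uu' u'v' v'v bI' kI]]] := @bad_subinterval _ f u v n%:R uv _ _ bI.
  - exact: derivative_tower_sub ft.
  - by move=> s sI; apply: fp; lra.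
  have h : [/\ x <= (u', v').1, (u', v').1 <= (u', v').2, (u', v').2 <= y &
    ~ uniformly_geometric f (u', v').1 (u', v').2] by split => //=; lra.
  by exists (exist _ (u', v') h).
have I0 : badI by exists (x, y).
pose fix I n : badI := if n is n'.+1 then sval (step (I n') n') else I0.
have Iw n : (sval (I n)).1 <= (sval (I n)).2 by case: (sval (I n)) (svalP (I n)) => u v [].
have Ihom m n : (m <= n)%N ->
    (sval (I m)).1 <= (sval (I n)).1 /\ (sval (I n)).2 <= (sval (I m)).2.
  move=> /subnK <-; elim: (n - m)%N => [|k [IH1 IH2]] //.
  rewrite addSn /=; have [h1 h2 _] := svalP (step (I (k + m)%N) (k + m)%N).
  by split; [apply: le_trans IH1 h1|apply: le_trans h2 IH2].
pose A := [set (sval (I n)).1 | n in setT].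
pose s := sup A.
have Aub n : ubound A (sval (I n)).2.
  move=> _ [m _ <-]; have [h1 _] := Ihom m _ (leq_maxl m n).
  have [_ h2] := Ihom n _ (leq_maxr m n).
  by apply: le_trans h1 (le_trans (Iw _) h2).
have sI n : (sval (I n)).1 <= s <= (sval (I n)).2.
  apply/andP; split.
    by apply: ub_le_sup; [exists (sval (I n)).2; exact: Aub|exists n].
  by apply: ge_sup; [exists (sval (I n)).1, n|exact: Aub].
have [K fK] : exists K, pointwise_geometric f K s.
  apply: fp; have [/andP[h1 h2]] := sI 0%N.
  by case: (svalP (I 0%N)) => ? ? ? _; lra.
have K0 := pointwise_geometric_ge0 fK.
pose n := (Num.truncn K).+1.
have Kn : K < n%:R by exact: truncnS_gt.
have [_ _ [k hk]] := svalP (step (I n) n).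
have := lt_le_trans (hk s (sI n.+1)) (fK k).
by rewrite ltNge lerXn2r ?nnegrE ?ler0n// ltW.
Qed.

(* Only pointwise geometric bounds are assumed: this is the Pringsheim-Boas
   theorem, and it is why no uniformity in time is needed for uniqueness. *)
Lemma tower_taylor_cvg (R : realType) (f : nat -> R -> R) (t : R) :
  0 <= t -> derivative_tower f 0 t ->
  (forall s, 0 <= s <= t -> exists K, pointwise_geometric f K s) ->
  series (fun l => f l 0 * t ^+ l / l`!%:R) @ \oo --> f 0%N t.
Proof.
move=> t0 ft fp; have fu := tower_uniformly_geometric t0 ft fp.
apply/cvgrPdist_le => e e0.
have [||N _ hN] := @taylor_remainder_cvg _ f 0 t 0 t e ft fu _ _ e0; try lra.
exists N.+1 => // -[//|n] /= Nn; have := hN n Nn.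
by rewrite /= subr0 /series /= big_mkord.
Qed.

(** * Differentiation of complex-valued functions *)

Lemma normr_complexE (R : realType) (z : R[i]) : `|z| = (normc z)%:C.
Proof. by []. Qed.

(** The norm of [R[i]] takes its values in [R[i]]; a positive element there is real, so real radii
    suffice. *)
Lemma cvg_complexP (R : realType) (T : Type) (F : set_system T) {FF : Filter F}
    (g : T -> R[i]) (l : R[i]) :
  ((g : T -> (R[i] : numFieldType)) @ F --> (l : (R[i] : numFieldType))) <->
  (forall e : R, 0 < e -> \forall h \near F, normc (l - g h) <= e).
Proof.
split => [/cvgrPdist_le gl e e0|gl].
  have e0' : 0 < e%:C by rewrite ltcR.
  have := gl _ e0'; apply: filterS => h /=.
  by rewrite normr_complexE lecR.
apply/cvgrPdist_le => e e0.
have eE : e = (complex.Re e)%:C by rewrite RRe_real// ger0_real// ltW.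
rewrite eE ltcR in e0; have := gl _ e0; apply: filterS => h hh.
by rewrite eE normr_complexE lecR.
Qed.

(** Merges the one-sided limit at 0 with the two-sided limit elsewhere, so that each differentiation
    rule is proved once. *)
Definition dfilter (R : realType) (t : R) : set_system R :=
  if t == 0 then 0^'+ else 0^'.

Instance dfilter_proper (R : realType) (t : R) : ProperFilter (dfilter t).
Proof. by rewrite /dfilter; case: ifP => _; typeclasses eauto. Qed.

Lemma dfilter_filter (R : realType) (t : R) : Filter (dfilter t).
Proof. exact: filter_filter. Qed.

Lemma has_derivE (R : realType) (f : R -> R[i]) (t : R) (l : R[i]) :
  has_deriv_on0 f t l =
  ((fun h : R => (h%:C)^-1 * (f (t + h) - f t) : (R[i] : numFieldType))
     @ dfilter t --> (l : (R[i] : numFieldType))).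
Proof. by rewrite /has_deriv_on0 /dfilter; case: ifP. Qed.

Lemma dfilter_sub (R : realType) (t : R) (P : set R) :
  (\forall h \near 0^', P h) -> \forall h \near dfilter t, P h.
Proof.
rewrite /dfilter; case: ifP => // _.
move=> [e /= e0 h]; exists e => //= x xe x0; apply: h => //.
by rewrite gt_eqF.
Qed.

Lemma dfilter_neq0 (R : realType) (t : R) : \forall h \near dfilter t, h != 0.
Proof. by apply: dfilter_sub; exists 1 => //=. Qed.

Lemma dfilter_small (R : realType) (t e : R) : 0 < e ->
  \forall h \near dfilter t, `|h| <= e.
Proof.
move=> e0; apply: dfilter_sub; exists e => //= x + _.
by rewrite /ball_ /= sub0r normrN => /ltW.
Qed.

Lemma dfilter_cvg0 (R : realType) (t : R) :
  (fun h : R => h%:C : (R[i] : numFieldType)) @ dfilter t --> (0 : (R[i] : numFieldType)).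
Proof.
apply/cvg_complexP => e e0; apply: filterS (dfilter_small t e0) => h.
by rewrite sub0r normcN /normc /= expr0n /= addr0 sqrtr_sqr.
Qed.

Lemma cvg_complex_eq (R : realType) (T : Type) (F : set_system T)
    (f g : T -> (R[i] : numFieldType)) (l m : (R[i] : numFieldType)) :
  f =1 g -> l = m -> f @ F --> l -> g @ F --> m.
Proof. by move=> /funext -> ->. Qed.

Lemma cvg_complexM (R : realType) (T : Type) (F : set_system T) (FF : Filter F)
    (f g : T -> (R[i] : numFieldType)) (l m : (R[i] : numFieldType)) :
  f @ F --> l -> g @ F --> m -> (fun h => f h * g h) @ F --> l * m.
Proof. by move=> fl gm; exact: (@cvgM (R[i] : numFieldType) _ _ _ _ _ _ _ fl gm). Qed.

Lemma cvg_complexD (R : realType) (T : Type) (F : set_system T) (FF : Filter F)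
    (f g : T -> (R[i] : numFieldType)) (l m : (R[i] : numFieldType)) :
  f @ F --> l -> g @ F --> m -> (fun h => f h + g h) @ F --> l + m.
Proof.
move=> fl gm.
exact: (@cvgD (R[i] : numFieldType) (R[i] : numFieldType) _ _ _ _ _ _ _ fl gm).
Qed.

Lemma has_deriv_cvg (R : realType) (f : R -> R[i]) (t : R) (l : R[i]) :
  has_deriv_on0 f t l ->
  (fun h => f (t + h) : (R[i] : numFieldType)) @ dfilter t --> (f t : (R[i] : numFieldType)).
Proof.
rewrite has_derivE => fl.
have : (fun h => f t + h%:C * ((h%:C)^-1 * (f (t + h) - f t)) : (R[i] : numFieldType))
    @ dfilter t --> (f t + 0 * l : (R[i] : numFieldType)).
  apply: cvg_complexD; first exact: cvg_cst.
  by apply: cvg_complexM fl; exact: dfilter_cvg0.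
rewrite mul0r addr0; apply: cvg_trans; apply: near_eq_cvg.
apply: filterS (dfilter_neq0 t) => h h0.
have h0' : h%:C != 0 :> R[i] by rewrite fmorph_eq0.
suff E (K : fieldType) (a b c : K) : c != 0 -> a + c * (c^-1 * (b - a)) = b.
  exact: (E R[i]).
by move=> c0; rewrite mulVKf// addrC subrK.
Qed.

Lemma has_deriv_ext (R : realType) (f g : R -> R[i]) (t : R) (l l' : R[i]) :
  f =1 g -> l = l' -> has_deriv_on0 f t l -> has_deriv_on0 g t l'.
Proof. by move=> /funext -> ->. Qed.

Lemma has_deriv_cst (R : realType) (c : R[i]) (t : R) :
  has_deriv_on0 (fun=> c) t 0.
Proof.
rewrite has_derivE; under eq_fun do rewrite subrr mulr0; exact: cvg_cst.
Qed.

Lemma has_derivD (R : realType) (f g : R -> R[i]) (t : R) (l m : R[i]) :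
  has_deriv_on0 f t l -> has_deriv_on0 g t m ->
  has_deriv_on0 (fun s => f s + g s) t (l + m).
Proof.
rewrite !has_derivE => fl gm.
apply: (cvg_complex_eq _ _ (cvg_complexD (dfilter_filter t) fl gm)) => // h.
rewrite -mulrDr; congr (_ * _).
by rewrite opprD addrACA.
Qed.

Lemma has_derivM (R : realType) (f g : R -> R[i]) (t : R) (l m : R[i]) :
  has_deriv_on0 f t l -> has_deriv_on0 g t m ->
  has_deriv_on0 (fun s => f s * g s) t (l * g t + f t * m).
Proof.
move=> fl gm; have gc := has_deriv_cvg gm.
move: fl gm; rewrite !has_derivE => fl gm.
have fg := cvg_complexM (dfilter_filter t) fl gc.
have cf : (fun=> f t : (R[i] : numFieldType)) @ dfilter t
  --> (f t : (R[i] : numFieldType)) by exact: cvg_cst.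
have gf := cvg_complexM (dfilter_filter t) cf gm.
have := cvg_complexD (dfilter_filter t) fg gf; apply: cvg_complex_eq => //.
suff E (K : comNzRingType) (c a a' b b' : K) :
    c * (a' - a) * b' + a * (c * (b' - b)) = c * (a' * b' - a * b).
  by move=> h; exact: (E R[i]).
by ring.
Qed.

Lemma has_derivN (R : realType) (f : R -> R[i]) (t : R) (l : R[i]) :
  has_deriv_on0 f t l -> has_deriv_on0 (fun s => - f s) t (- l).
Proof.
move=> fl; have := has_derivM (has_deriv_cst (-1) t) fl.
by apply: has_deriv_ext => [s|]; rewrite mulN1r// mul0r add0r.
Qed.

Lemma Re_le_normc (R : realType) (z : R[i]) : `|complex.Re z| <= normc z.
Proof. by rewrite -lecR; exact: normc_ge_Re. Qed.

Lemma Im_le_normc (R : realType) (z : R[i]) : `|complex.Im z| <= normc z.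
Proof.
case: z => a b /=; rewrite -sqrtr_sqr ler_sqrt ?addr_ge0 ?sqr_ge0//.
by rewrite lerDr sqr_ge0.
Qed.

Lemma normc_le_ReIm (R : realType) (z : R[i]) : normc z <= `|complex.Re z| + `|complex.Im z|.
Proof.
case: z => a b /=.
rewrite -[leRHS]ger0_norm ?addr_ge0// -sqrtr_sqr ler_sqrt ?sqr_ge0//.
rewrite sqrrD !real_normK ?num_real// addrAC lerDl.
by rewrite mulrn_wge0// mulr_ge0.
Qed.

Lemma complex_ReD (R : realType) (z w : R[i]) :
  complex.Re (z + w) = complex.Re z + complex.Re w.
Proof. by case: z w => [a b] [c d]. Qed.

Lemma complex_ImD (R : realType) (z w : R[i]) :
  complex.Im (z + w) = complex.Im z + complex.Im w.
Proof. by case: z w => [a b] [c d]. Qed.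

Lemma complex_ReN (R : realType) (z : R[i]) : complex.Re (- z) = - complex.Re z.
Proof. by case: z. Qed.

Lemma complex_ImN (R : realType) (z : R[i]) : complex.Im (- z) = - complex.Im z.
Proof. by case: z. Qed.

Lemma complex_ReZ (R : realType) (a : R) (z : R[i]) :
  complex.Re (a%:C * z) = a * complex.Re z.
Proof. by case: z => u v /=; rewrite mul0r subr0. Qed.

Lemma complex_ImZ (R : realType) (a : R) (z : R[i]) :
  complex.Im (a%:C * z) = a * complex.Im z.
Proof. by case: z => u v /=; rewrite mul0r addr0. Qed.

Lemma is_derive_cvgP (R : realType) (g : R -> R) (t l : R) :
  is_derive t 1 g l <-> (fun h => h^-1 * (g (t + h) - g t)) @ 0^' --> l.
Proof.
have E : (fun h => h^-1 * (g (t + h) - g t)) =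
    (fun h : R => h^-1 *: (g (h *: 1 + t) - g t)).
  by apply/funext => h; rewrite /GRing.scale /= mulr1 [t + h]addrC.
rewrite E; split=> [[d <-]|h]; first exact: d.
by apply: DeriveDef; [exact: cvgP h|exact: cvg_lim h].
Qed.

(** Valid at [t = 0] too, since a two-sided limit restricts to the right; the converse lemmas
    require [t != 0]. *)
Lemma has_deriv_of_parts (R : realType) (f : R -> R[i]) (t : R) (l : R[i]) :
  is_derive t 1 (@complex.Re R \o f) (complex.Re l) ->
  is_derive t 1 (@complex.Im R \o f) (complex.Im l) ->
  has_deriv_on0 f t l.
Proof.
move=> /is_derive_cvgP /cvgrPdist_le fr /is_derive_cvgP /cvgrPdist_le fi.
rewrite has_derivE; apply/cvg_complexP => e e0.
have e2 : 0 < e / 2 by lra.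
apply: dfilter_sub; have := fi _ e2; have := fr _ e2; apply: filterS2 => h /= hr hi.
apply: le_trans (normc_le_ReIm _) _.
rewrite -fmorphV !(complex_ReD, complex_ImD, complex_ReN, complex_ImN).
rewrite !(complex_ReZ, complex_ImZ) !(complex_ReD, complex_ImD, complex_ReN, complex_ImN).
lra.
Qed.

Lemma is_derive_Re (R : realType) (f : R -> R[i]) (t : R) (l : R[i]) : t != 0 ->
  has_deriv_on0 f t l -> is_derive t 1 (@complex.Re R \o f) (complex.Re l).
Proof.
move=> t0; rewrite has_derivE /dfilter (negbTE t0) => /cvg_complexP fl.
apply/is_derive_cvgP/cvgrPdist_le => e e0.
have := fl _ e0; apply: filterS => h; apply: le_trans.
apply: le_trans (Re_le_normc _).
by rewrite -fmorphV !(complex_ReD, complex_ReN, complex_ReZ).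
Qed.

Lemma is_derive_Im (R : realType) (f : R -> R[i]) (t : R) (l : R[i]) : t != 0 ->
  has_deriv_on0 f t l -> is_derive t 1 (@complex.Im R \o f) (complex.Im l).
Proof.
move=> t0; rewrite has_derivE /dfilter (negbTE t0) => /cvg_complexP fl.
apply/is_derive_cvgP/cvgrPdist_le => e e0.
have := fl _ e0; apply: filterS => h; apply: le_trans.
apply: le_trans (Im_le_normc _).
by rewrite -fmorphV !(complex_ImD, complex_ImN, complex_ImZ).
Qed.

Lemma has_deriv_cvg_right (R : realType) (f : R -> R[i]) (l : R[i]) (p : R[i] -> R) :
  (forall z w, `|p z - p w| <= normc (z - w)) ->
  has_deriv_on0 f 0 l -> (p \o f) @ 0^'+ --> p (f 0).
Proof.
move=> pl /has_deriv_cvg; rewrite /dfilter eqxx => /cvg_complexP fl.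
apply/cvgrPdist_le => e e0.
have := fl _ e0; apply: filterS => h; apply: le_trans.
by rewrite /= add0r; exact: pl.
Qed.

Lemma is_derive_continuous (R : realType) (g : R -> R) (t l : R) :
  is_derive t 1 g l -> {for t, continuous g}.
Proof. by move=> [d _]; apply/differentiable_continuous/derivable1_diffP. Qed.

Lemma Re_dist (R : realType) (z w : R[i]) :
  `|complex.Re z - complex.Re w| <= normc (z - w).
Proof. by apply: le_trans (Re_le_normc _); rewrite complex_ReD complex_ReN. Qed.

Lemma Im_dist (R : realType) (z w : R[i]) :
  `|complex.Im z - complex.Im w| <= normc (z - w).
Proof. by apply: le_trans (Im_le_normc _); rewrite complex_ImD complex_ImN. Qed.

Lemma within_continuous_of_deriv (R : realType) (g g' : R -> R) (T : R) :
  0 < T -> g @ 0^'+ --> g 0 ->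
  (forall t, 0 < t <= T -> is_derive t 1 g (g' t)) ->
  {within `[0, T], continuous g}.
Proof.
move=> T0 g0 dg; apply/(continuous_within_itvP _ T0); split => //.
  move=> t; rewrite in_itv /= => /andP[t0 tT].
  by apply: is_derive_continuous (dg t _); rewrite t0 ltW.
apply: cvg_at_left_filter; apply: is_derive_continuous (dg T _).
by rewrite T0 lexx.
Qed.

Lemma derivative_tower_Re (R : realType) (f : nat -> R -> R[i]) (delta T : R) :
  0 < T < delta ->
  (forall k t, 0 <= t < delta -> has_deriv_on0 (f k) t (f k.+1 t)) ->
  derivative_tower (fun k => @complex.Re R \o f k) 0 T.
Proof.
move=> /andP[T0 Td] df k; split.
  apply: (@within_continuous_of_deriv _ _ (@complex.Re R \o f k.+1)) => //.
    by apply: has_deriv_cvg_right (df k 0 _); [exact: Re_dist|lra].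
  move=> t tT; apply: is_derive_Re; first by rewrite gt_eqF; lra.
  by apply: df; lra.
move=> t tT; apply: is_derive_Re; first by rewrite gt_eqF; lra.
by apply: df; lra.
Qed.

Lemma derivative_tower_Im (R : realType) (f : nat -> R -> R[i]) (delta T : R) :
  0 < T < delta ->
  (forall k t, 0 <= t < delta -> has_deriv_on0 (f k) t (f k.+1 t)) ->
  derivative_tower (fun k => @complex.Im R \o f k) 0 T.
Proof.
move=> /andP[T0 Td] df k; split.
  apply: (@within_continuous_of_deriv _ _ (@complex.Im R \o f k.+1)) => //.
    by apply: has_deriv_cvg_right (df k 0 _); [exact: Im_dist|lra].
  move=> t tT; apply: is_derive_Im; first by rewrite gt_eqF; lra.
  by apply: df; lra.
move=> t tT; apply: is_derive_Im; first by rewrite gt_eqF; lra.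
by apply: df; lra.
Qed.

Lemma complex_tower_expser (R : realType) (f : nat -> R -> R[i]) (delta : R) :
  (forall k t, 0 <= t < delta -> has_deriv_on0 (f k) t (f k.+1 t)) ->
  (forall t, 0 <= t < delta -> exists K, forall k, normc (f k t) <= K ^+ k.+1) ->
  forall t, 0 <= t < delta -> expser (fun l => f l 0) t = f 0%N t.
Proof.
move=> df fb t tdelta.
(* The tower lemmas need an interval of positive length inside the domain; [t] may be 0, whereas the
   midpoint lies strictly between 0 and [delta]. *)
pose T := (t + delta) / 2.
have T0 : 0 < T < delta by rewrite /T; lra.
have tT : t <= T by rewrite /T; lra.
have cr : series (fun l => complex.Re (f l 0) * t ^+ l / l`!%:R) @ \oo
    --> complex.Re (f 0%N t).
  apply: (@tower_taylor_cvg _ (fun k => @complex.Re R \o f k)); first lra.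
    apply: derivative_tower_sub (derivative_tower_Re T0 df) => //.
  move=> s st; have [|K fK] := fb s; first lra.
  by exists K => k; apply: le_trans (Re_le_normc _) (fK k).
have ci : series (fun l => complex.Im (f l 0) * t ^+ l / l`!%:R) @ \oo
    --> complex.Im (f 0%N t).
  apply: (@tower_taylor_cvg _ (fun k => @complex.Im R \o f k)); first lra.
    apply: derivative_tower_sub (derivative_tower_Im T0 df) => //.
  move=> s st; have [|K fK] := fb s; first lra.
  by exists K => k; apply: le_trans (Im_le_normc _) (fK k).
rewrite /expser; apply: (@cvg_lim (R[i] : numFieldType)); first exact: norm_hausdorff.
apply/cvg_complexP => e e0.
have e2 : 0 < e / 2 by lra.
move/cvgrPdist_le : cr => /(_ _ e2); move/cvgrPdist_le : ci => /(_ _ e2).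
apply: filterS2 => n hi hr.
apply: le_trans (normc_le_ReIm _) _.
have tE l : f l 0 * t%:C ^+ l / l`!%:R = (t ^+ l / l`!%:R)%:C * f l 0.
  by rewrite rmorphM fmorphV rmorphXn rmorph_nat -mulrA mulrC.
have rE : complex.Re (series (fun l => f l 0 * t%:C ^+ l / l`!%:R) n) =
    series (fun l => complex.Re (f l 0) * t ^+ l / l`!%:R) n.
  rewrite /series /= (big_morph _ (@complex_ReD R) (erefl : complex.Re 0 = 0)).
  by apply: eq_bigr => l _; rewrite tE complex_ReZ mulrC mulrA.
have iE : complex.Im (series (fun l => f l 0 * t%:C ^+ l / l`!%:R) n) =
    series (fun l => complex.Im (f l 0) * t ^+ l / l`!%:R) n.
  rewrite /series /= (big_morph _ (@complex_ImD R) (erefl : complex.Im 0 = 0)).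
  by apply: eq_bigr => l _; rewrite tE complex_ImZ mulrC mulrA.
rewrite !(complex_ReD, complex_ImD, complex_ReN, complex_ImN) rE iE.
lra.
Qed.

(** * Integrating factors *)

Lemma exists_primitive (R : realType) (f : R -> R) : continuous f ->
  exists F : R -> R, forall x : R, 0 <= x -> is_derive x 1 F (f x).
Proof.
move=> fc.
suff [F dF] : exists F : R -> R,
    forall x : R, 0 <= x -> derivable F x 1 /\ derive1 F x = f x.
  by exists F => x /dF[d dE]; apply: DeriveDef => //; rewrite -derive1E.
(* Integration starts at -1 so that 0 is interior and the derivative there is two-sided. *)
exists (fun x => (\int[lebesgue_measure]_(t in `[-1, x]) f t)%R) => x x0.
have int : lebesgue_measure.-integrable `[-1, x + 1] (EFin \o f).
  apply: continuous_compact_integrable; first exact: segment_compact.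
  exact: continuous_subspaceT.
apply: (@continuous_FTC1 R f (BLeft (-1)) x (x + 1) _ int _ _).
- by lra.
- by rewrite ?lte_fin /=; lra.
- exact: fc.
Qed.

(** Freezing [h] outside the interval makes it continuous on the whole line, as [exists_primitive]
    requires. The clamp is 1-Lipschitz with values in the interval. *)
Lemma continuous_clamp (R : realType) (h : R -> R) (T : R) :
  0 <= T -> {within `[0, T], continuous h} ->
  continuous (fun x : R => h (Num.min T (Num.max 0 x))).
Proof.
move=> T0 hc x; pose c y : R := Num.min T (Num.max 0 y).
have cA y : `[0, T]%classic (c y).
  by rewrite /= in_itv /= /c; case: (leP 0 y) => ?;
    [case: (leP T y)|case: (leP T 0)] => ?; lra.
have cl y : `|c x - c y| <= `|x - y|.
  have : x - y <= `|x - y| by exact: ler_norm.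
  have : y - x <= `|x - y| by rewrite distrC; exact: ler_norm.
  rewrite ler_norml /c => h1 h2.
  case: (leP 0 x) => ?; case: (leP 0 y) => ?; rewrite ?(min_r T0);
    try case: (leP T x) => ?; try case: (leP T y) => ?; lra.
have hcx : h @ within `[0, T] (nbhs (c x)) --> h (c x).
  by rewrite (nbhs_subspace_in (cA x)); exact: hc.
apply: (@cvg_comp _ _ _ c h _ _ _ _ hcx) => B /nbhs_ballP[e /= e0 he].
apply/nbhs_ballP; exists e => //= y xy; apply: he; last exact: cA.
exact: le_lt_trans (cl y) xy.
Qed.

(** [tau] is the exponential of a primitive of [g], written through modulus and argument: the real
    part of [g] integrates to the logarithm of the modulus, the imaginary part to the angle. *)
Lemma exists_integrating_factor (R : realType) (g g' : R -> R[i]) (delta T : R) :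
  0 < T < delta ->
  (forall t, 0 <= t < delta -> has_deriv_on0 g t (g' t)) ->
  exists tau : R -> R[i], [/\ tau 0 = 1, forall t, tau t != 0 &
    forall t, 0 <= t < T -> has_deriv_on0 tau t (g t * tau t)].
Proof.
move=> Td dg; have [T0 _] := andP Td.
have cr : {within `[0, T], continuous (@complex.Re R \o g)}.
  apply: (@within_continuous_of_deriv _ _ (@complex.Re R \o g')) => //.
    by apply: has_deriv_cvg_right (dg 0 _); [exact: Re_dist|lra].
  by move=> t tT; apply: is_derive_Re; [rewrite gt_eqF; lra|apply: dg; lra].
have ci : {within `[0, T], continuous (@complex.Im R \o g)}.
  apply: (@within_continuous_of_deriv _ _ (@complex.Im R \o g')) => //.
    by apply: has_deriv_cvg_right (dg 0 _); [exact: Im_dist|lra].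
  by move=> t tT; apply: is_derive_Im; [rewrite gt_eqF; lra|apply: dg; lra].
have [F dF] := exists_primitive (continuous_clamp (ltW T0) cr).
have [G dG] := exists_primitive (continuous_clamp (ltW T0) ci).
pose e t := expR (F t - F 0); pose th t := G t - G 0.
exists (fun t => (e t * cos (th t)) +i* (e t * sin (th t))); split.
- by rewrite /e /th !subrr expR0 cos0 sin0 mulr1 mulr0.
- move=> t; apply/negP; rewrite eq_complex /= => /andP[].
  have e0 : (e t == 0) = false by rewrite gt_eqF// expR_gt0.
  rewrite !mulf_eq0 e0 /= => /eqP c0 /eqP s0; have := cos2Dsin2 (th t).
  by rewrite c0 s0 expr0n /= addr0 => /eqP; rewrite eq_sym oner_eq0.
move=> t tT; have cl : Num.min T (Num.max 0 t) = t.
  by rewrite max_r ?min_r; lra.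
have t0 : 0 <= t by lra.
have dFt := dF t t0; have dGt := dG t t0; rewrite /= cl in dFt dGt.
have de : is_derive t 1 e (e t * complex.Re (g t)).
  have -> : e = expR \o (F - cst (F 0)) by [].
  apply: is_derive_eq; rewrite /= subr0 /GRing.scale /= !fctE; ring.
have dth : is_derive t 1 th (complex.Im (g t)).
  have -> : th = (G - cst (G 0)) by [].
  by apply: is_derive_eq; rewrite subr0.
apply: has_deriv_of_parts.
  have -> : @complex.Re R \o (fun t => (e t * cos (th t)) +i* (e t * sin (th t))) =
    e * (cos \o th) by [].
  apply: is_derive_eq; case: (g t) => a b /=; rewrite /GRing.scale /=; ring.
have -> : @complex.Im R \o (fun t => (e t * cos (th t)) +i* (e t * sin (th t))) =
  e * (sin \o th) by [].
apply: is_derive_eq; case: (g t) => a b /=; rewrite /GRing.scale /=; ring.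
Qed.

(** * Powers of the band matrices *)

(* [wpow e d c x k y] is the (x, y) entry of the k-th power of the matrix with
   ones on the e-th superdiagonal and [c] on the d-th subdiagonal: it covers
   both L1 (e = r, d = 1) and L2 (e = 1, d = q). *)
Fixpoint wpow (K : pzRingType) (e d : nat) (c : nat -> K) (x k y : nat) : K :=
  if k is k'.+1 then
    (if (e <= y)%N then wpow e d c x k' (y - e) else 0)
      + wpow e d c x k' (y + d) * c y
  else (x == y)%:R.

Lemma sum_shifted_delta (K : pzRingType) (P : nat -> K) (e y n : nat) :
  (y < n)%N ->
  \sum_(l < n) P l * (if y == (l + e)%N then 1 else 0) =
  if (e <= y)%N then P (y - e)%N else 0.
Proof.
move=> yn; case: leqP => ey; last first.
  by rewrite big1 // => l _; case: eqP => [?|_]; [lia|rewrite mulr0].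
have ln : (y - e < n)%N by lia.
rewrite (bigD1 (Ordinal ln)) //= subnK// eqxx mulr1 big1 ?addr0// => l.
rewrite -val_eqE /= => /eqP ne; case: eqP => [?|_]; last by rewrite mulr0.
lia.
Qed.

(** The truncation stops exactly at row [y + d], so the last summand carries the subdiagonal entry
    and all earlier ones can meet only the superdiagonal. *)
Lemma infmx_powS_banded (R : realType) (L : infmx R) (c : nat -> R[i]) (e d : nat)
    (cb : nat -> nat) (k x y : nat) :
  (0 < d)%N -> cb y = (y + d).+1 ->
  (forall i j, L i j = if j == (i + e)%N then 1 else if i == (j + d)%N then c j else 0) ->
  infmx_pow cb L k.+1 x y =
  (if (e <= y)%N then infmx_pow cb L k x (y - e)%N else 0)
    + infmx_pow cb L k x (y + d)%N * c y.
Proof.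
move=> d0 cbE LE; rewrite /= /infmx_mul cbE big_ord_recr /= LE.
case: eqP => [?|_]; first lia.
rewrite eqxx; congr (_ + _).
rewrite -(@sum_shifted_delta _ (infmx_pow cb L k x) e y (y + d)); last lia.
apply: eq_bigr => -[l ln] _ /=; rewrite LE; case: eqP => // _.
by case: eqP => // ?; lia.
Qed.

Lemma L1_powE (R : realType) (r : nat) (a : nat -> R[i]) (k x y : nat) :
  infmx_pow (L1_colbound r) (L1 r a) k x y = wpow r 1 a x k y.
Proof.
elim: k y => [|k IH] y; first by rewrite /= /infmx1; case: eqP.
rewrite (@infmx_powS_banded _ _ a r 1) //=; last 2 first.
- by rewrite /L1_colbound addn1.
- by move=> i j; rewrite /L1 addn1.
by rewrite !IH.
Qed.

Lemma L2_powE (R : realType) (q : nat) (b : nat -> R[i]) (k x y : nat) :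
  (0 < q)%N ->
  infmx_pow (L2_colbound q) (L2 q b) k x y = wpow 1 q b x k y.
Proof.
move=> q0; elim: k y => [|k IH] y; first by rewrite /= /infmx1; case: eqP.
rewrite (@infmx_powS_banded _ _ b 1 q) //=; last first.
  by move=> i j; rewrite /L2 addn1.
by rewrite !IH.
Qed.

(** Cutting the product at [N] loses nothing, as column [y] of the [j]-th power vanishes in rows
    beyond [y + d * j]. *)
Lemma wpow_add (K : pzRingType) (e d : nat) (c : nat -> K) (x m j y N : nat) :
  (y + d * j < N)%N ->
  wpow e d c x (m + j) y = \sum_(l < N) wpow e d c x m l * wpow e d c l j y.
Proof.
elim: j y => [|j IH] y yN.
  have yN' : (y < N)%N by lia.
  rewrite addn0 (bigD1 (Ordinal yN')) //= eqxx mulr1 big1 ?addr0// => l.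
  by rewrite -val_eqE /= => /negbTE ->; rewrite mulr0.
rewrite addnS /= (IH (y + d)%N); last by move: yN; rewrite mulnS; lia.
case: leqP => ey.
  rewrite IH; last by move: yN; rewrite mulnS; lia.
  by rewrite mulr_suml -big_split; apply: eq_bigr => l _; rewrite mulrDr mulrA.
rewrite add0r mulr_suml; apply: eq_bigr => l _; by rewrite add0r mulrA.
Qed.

(** An entry of the [k]-th power sums over [k]-step paths that rise by [e] with weight 1 or drop by
    [d] with weight [c]. This lemma and the next three give the reachable range and the weight of
    the unique extreme path, all rises or all drops. *)
Lemma wpow_row_support (K : pzRingType) (e d : nat) (c : nat -> K) (x k y : nat) :
  (x + e * k < y)%N -> wpow e d c x k y = 0.
Proof.
elim: k y => [|k IH] y /=.
  by move=> h; case: eqP => // ?; lia.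
rewrite mulnS => h; rewrite (IH (y + d)%N); last lia.
by rewrite mul0r addr0; case: leqP => // ?; rewrite IH //; lia.
Qed.

Lemma wpow_row_diag (K : pzRingType) (e d : nat) (c : nat -> K) (x k : nat) :
  (0 < d)%N -> wpow e d c x k (x + e * k) = 1.
Proof.
move=> d0; elim: k => [|k IH] /=; first by rewrite muln0 addn0 eqxx.
rewrite (_ : (e <= _)%N); last by rewrite mulnS; lia.
rewrite (@wpow_row_support _ _ _ _ _ _ (_ + d)) ?mul0r ?addr0; last first.
  by rewrite mulnS; lia.
by rewrite mulnS addnCA addnC addnK.
Qed.

Lemma wpow_col_support (K : pzRingType) (e d : nat) (c : nat -> K) (x k y : nat) :
  (y + d * k < x)%N -> wpow e d c x k y = 0.
Proof.
elim: k y => [|k IH] y /=.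
  by move=> h; case: eqP => // ?; lia.
rewrite mulnS => h; rewrite (IH (y + d)%N); last lia.
by rewrite mul0r addr0; case: leqP => // ?; rewrite IH //; lia.
Qed.

Lemma wpow_col_diag (K : comPzRingType) (e d : nat) (c : nat -> K) (y k : nat) :
  (0 < d)%N -> wpow e d c (y + d * k) k y = \prod_(i < k) c (y + d * i)%N.
Proof.
move=> d0; elim: k y => [|k IH] y /=; first by rewrite muln0 addn0 eqxx big_ord0.
rewrite (_ : (if _ then _ else _) = 0); last first.
  by case: leqP => // ?; rewrite wpow_col_support// mulnS; lia.
rewrite mulnS addnA IH add0r big_ord_recl muln0 addn0 mulrC; congr (_ * _).
by apply: eq_bigr => i _; rewrite /bump /= mulnDr muln1 addnA.
Qed.

Lemma det_LU (K : comNzRingType) (n : nat) (alpha u v : nat -> nat -> K) (p : nat -> K) :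
  (forall i l, (i < l)%N -> u i l = 0) -> (forall i, u i i = 1) ->
  (forall l j, (j < l)%N -> v l j = 0) -> (forall j, v j j = p j) ->
  (forall i j, (i < n)%N -> (j < n)%N -> alpha i j = \sum_(l < n) u i l * v l j) ->
  \det (\matrix_(i < n, j < n) alpha i j) = \prod_(j < n) p j.
Proof.
move=> u0 u1 v0 vp alphaE.
have -> : \matrix_(i < n, j < n) alpha i j =
  (\matrix_(i < n, j < n) u i j) *m (\matrix_(i < n, j < n) v i j).
  apply/matrixP => i j; rewrite !mxE alphaE//.
  by apply: eq_bigr => l _; rewrite !mxE.
rewrite det_mulmx det_trig; last first.
  by apply/is_trig_mxP => i j ij; rewrite mxE u0.
rewrite -det_tr det_trig; last first.
  by apply/is_trig_mxP => i j ij; rewrite !mxE v0.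
rewrite big1 ?mul1r => [|i _]; last by rewrite mxE u1.
by apply: eq_bigr => i _; rewrite !mxE vp.
Qed.

(** The power [i %/ r + j] is split after [i %/ r] factors. Row [i %% r] of the first power reaches
    exactly column [i], with entry 1; column 0 of the second reaches exactly row [j], with the
    product of the first [j] entries of [a]. *)
Lemma det_moments1 (K : comNzRingType) (r n : nat) (a : nat -> K) : (0 < r)%N ->
  \det (\matrix_(i < n, j < n) wpow r 1 a (i %% r) (i %/ r + j) 0) =
  \prod_(j < n) \prod_(i < j) a i.
Proof.
move=> r0.
apply: (@det_LU _ n (fun i j => wpow r 1 a (i %% r) (i %/ r + j) 0)
  (fun i l => wpow r 1 a (i %% r) (i %/ r) l) (fun l j => wpow r 1 a l j 0)
  (fun j => \prod_(i < j) a i)).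
- by move=> i l il; rewrite wpow_row_support// mulnC addnC -divn_eq.
- by move=> i; rewrite [X in wpow _ _ _ _ _ X](divn_eq i r) addnC mulnC wpow_row_diag.
- by move=> l j jl; rewrite wpow_col_support// mul1n.
- move=> j; have := @wpow_col_diag _ r 1 a 0 j isT; rewrite add0n mul1n => ->.
  by apply: eq_bigr => i _; rewrite add0n mul1n.
- by move=> i j _ jn; rewrite (@wpow_add _ _ _ _ _ _ _ _ n)// mul1n.
Qed.

(** Split after [i] factors: row 0 of the first power ends at column [i] with entry 1, and column
    [j %% q] of the second ends at row [j], reached by [j %/ q] drops. *)
Lemma det_moments2 (K : comNzRingType) (q n : nat) (b : nat -> K) : (0 < q)%N ->
  \det (\matrix_(i < n, j < n) wpow 1 q b 0 (i + j %/ q) (j %% q)) =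
  \prod_(j < n) \prod_(i < j %/ q) b (j %% q + q * i)%N.
Proof.
move=> q0.
apply: (@det_LU _ n (fun i j => wpow 1 q b 0 (i + j %/ q) (j %% q))
  (fun i l => wpow 1 q b 0 i l) (fun l j => wpow 1 q b l (j %/ q) (j %% q))
  (fun j => \prod_(i < j %/ q) b (j %% q + q * i)%N)).
- by move=> i l il; rewrite wpow_row_support// mul1n.
- by move=> i; have := @wpow_row_diag _ 1 q b 0 i q0; rewrite add0n mul1n.
- by move=> l j jl; rewrite wpow_col_support// mulnC addnC -divn_eq.
- move=> j; rewrite -(@wpow_col_diag _ 1 q b (j %% q) (j %/ q) q0).
  by rewrite [X in wpow _ _ _ X](divn_eq j q) addnC mulnC.
- move=> i j _ jn; rewrite (@wpow_add _ _ _ _ _ _ _ _ n)//.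
  by rewrite mulnC addnC -divn_eq.
Qed.

(** * Evolution of the moments *)

Lemma normc_triangle (R : realType) (z w : R[i]) : normc (z + w) <= normc z + normc w.
Proof. exact: le_normcD. Qed.

Lemma normc_ge0 (R : realType) (z : R[i]) : 0 <= normc z.
Proof. by apply: le_trans (Re_le_normc z). Qed.

Lemma linftyP (R : realType) (u : nat -> R[i]) :
  linfty u -> exists2 M : R, 0 <= M & forall i, normc (u i) <= M.
Proof.
move=> [M uM]; have h i : normc (u i) <= M by rewrite -lecR; exact: uM.
by exists M => //; apply: le_trans (h 0%N); exact: normc_ge0.
Qed.

Lemma normc_wpow (R : realType) (e d : nat) (c : nat -> R[i]) (M : R) (x k y : nat) :
  0 <= M -> (forall i, normc (c i) <= M) -> normc (wpow e d c x k y) <= (1 + M) ^+ k.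
Proof.
move=> M0 cM; elim: k y => [|k IH] y /=.
  by case: eqP => _; rewrite ?normc1 ?normc0 expr0.
apply: le_trans (normc_triangle _ _) _.
rewrite exprS mulrDl mul1r lerD//.
  by case: ifP => _ //; rewrite normc0 exprn_ge0// addr_ge0.
by rewrite normcM mulrC ler_pM// normc_ge0.
Qed.

Lemma has_deriv_prod (R : realType) (I : Type) (s : seq I) (f : I -> R -> R[i]) (t : R) :
  (forall i, exists l, has_deriv_on0 (f i) t l) ->
  exists l, has_deriv_on0 (fun x => \prod_(i <- s) f i x) t l.
Proof.
move=> df; elim: s => [|i s [l IH]].
  by exists 0; apply: has_deriv_ext (has_deriv_cst 1 t) => // x; rewrite big_nil.
have [m fm] := df i; eexists; apply: has_deriv_ext (has_derivM fm IH) => [x|//].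
by rewrite big_cons.
Qed.

Lemma has_deriv_sum (R : realType) (I : Type) (s : seq I) (f : I -> R -> R[i]) (t : R) :
  (forall i, exists l, has_deriv_on0 (f i) t l) ->
  exists l, has_deriv_on0 (fun x => \sum_(i <- s) f i x) t l.
Proof.
move=> df; elim: s => [|i s [l IH]].
  by exists 0; apply: has_deriv_ext (has_deriv_cst 0 t) => // x; rewrite big_nil.
have [m fm] := df i; eexists; apply: has_deriv_ext (has_derivD fm IH) => [x|//].
by rewrite big_cons.
Qed.

(* The quotient removes the unknown integrating factor of g: multiplied by it,
   the moments form a tower of derivatives. *)
Lemma normalized_moments (R : realType) (s s' : nat -> R -> R[i]) (g : R -> R[i])
    (p k0 : nat) (delta : R) :
  (forall t, 0 <= t < delta -> exists l, has_deriv_on0 g t l) ->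
  (forall k t, 0 <= t < delta -> has_deriv_on0 (s k) t (s (k + p)%N t - g t * s k t)) ->
  (forall k t, 0 <= t < delta -> has_deriv_on0 (s' k) t (s' (k + p)%N t - g t * s' k t)) ->
  (forall t, 0 <= t < delta -> exists2 M, 0 <= M &
     forall k, normc (s k t) <= (1 + M) ^+ k /\ normc (s' k t) <= (1 + M) ^+ k) ->
  (forall t, 0 <= t < delta -> s' k0 t = 1) ->
  forall k t, 0 <= t < delta ->
    s k t = expser (fun l => s (k + p * l)%N 0) t / expser (fun l => s' (k0 + p * l)%N 0) t.
Proof.
move=> dg ds ds' sM s'1 k t td.
have dg0 u : exists l, 0 <= u < delta -> has_deriv_on0 g u l.
  have [/dg[l gl]|ud] := boolP (0 <= u < delta); first by exists l.
  by exists 0.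
have [g' dg'] := boolp.choice dg0.
have Td : 0 < (t + delta) / 2 < delta by lra.
have [tau [tau0 tauN0 dtau]] := exists_integrating_factor Td dg'.
have main (S : nat -> R -> R[i]) j :
    (forall k t, 0 <= t < delta -> has_deriv_on0 (S k) t (S (k + p)%N t - g t * S k t)) ->
    (forall t, 0 <= t < delta ->
       exists2 M, 0 <= M & forall k, normc (S k t) <= (1 + M) ^+ k) ->
    expser (fun l => S (j + p * l)%N 0) t = tau t * S j t.
  move=> dS SM.
  have := @complex_tower_expser R (fun l x => tau x * S (j + p * l)%N x) ((t + delta) / 2).
  rewrite muln0 addn0 => <-; last lra.
  - by congr expser; apply/funext => l; rewrite tau0 mul1r.
  - move=> l x xT; apply: has_deriv_ext (has_derivM (dtau x xT) (dS _ x _)) => //; last lra.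
    by rewrite mulnS [(p + _)%N]addnC addnA; ring.
  move=> x xT; have [|M M0 hM] := SM x; first lra.
  (* The first factor absorbs the integrating factor; the exponent works because j + p l <= (j +
     p)(l + 1). *)
  exists ((1 + normc (tau x)) * (1 + M) ^+ (j + p)) => l.
  have n0 := normc_ge0 (tau x).
  rewrite normcM exprMn ler_pM ?normc_ge0//.
    apply: le_trans (_ : 1 + normc (tau x) <= _); first lra.
    by rewrite ler_eXnr// lerDl.
  apply: le_trans (hM _) _; rewrite -exprM ler_weXn2l ?lerDl//; nia.
(* As [s' k0] is identically 1, the denominator sums to [tau t]. *)
rewrite !main ?s'1 ?mulr1//; first by rewrite mulrAC divff ?mul1r.
- by move=> x xd; have [M M0 h] := sM x xd; exists M => // j; have [] := h j.
- by move=> x xd; have [M M0 h] := sM x xd; exists M => // j; have [] := h j.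
Qed.

(** Once the factor [a i] is absorbed, both products become windows of [r.+1] consecutive entries,
    starting at [i] and [i - r]. For [i < r] the second window contains an entry of negative index,
    hence the 0. *)
Lemma rhsAE (R : realType) (r : nat) (a : nat -> R[i]) (i : nat) : (0 < r)%N ->
  rhsA r a i = \prod_(0 <= j < r.+1) a (i + j)%N
    - (if (r <= i)%N then \prod_(0 <= j < r.+1) a (i - r + j)%N else 0).
Proof.
move=> r0; rewrite /rhsA mulrBr; congr (_ - _).
  by rewrite [RHS]big_ltn // addn0.
case: leqP => [ri|ir]; last first.
  by rewrite big_nat_recr //= leqNgt ir /= mulr0 mulr0.
rewrite big_nat_rev /= [RHS]big_nat_recr //= mulrC subnK//; congr (_ * _).
rewrite big_add1 /=; apply: eq_big_nat => j jr.
by rewrite (_ : (_ <= i)%N); [congr a; lia|lia].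
Qed.

(** Here the matrix A of the Lax equation has only the entries in places (y + r + 1, y), the
    products of [r.+1] consecutive entries of [a] from [y] on. Its rows up to [r] vanish, so for
    [x <= r] only the term L^k A remains. *)
Lemma has_deriv_moment1 (R : realType) (r : nat) (a : R -> nat -> R[i]) (t : R)
    (x k y : nat) : (0 < r)%N -> (x <= r)%N ->
  (forall i, has_deriv_on0 (fun s => a s i) t (rhsA r (a t) i)) ->
  has_deriv_on0 (fun s => wpow r 1 (a s) x k y) t
    (\prod_(0 <= j < r.+1) a t (y + j)%N * wpow r 1 (a t) x k (y + r.+1)).
Proof.
move=> r0 xr da; elim: k y => [|k IH] y /=.
  rewrite (_ : x == (y + r.+1)%N = false); last by apply/eqP; lia.
  by rewrite mulr0; exact: has_deriv_cst.
set Q := fun y => \prod_(0 <= j < r.+1) a t (y + j)%N.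
(* Both sides multiply the [r.+2] consecutive entries from [y] on: LA and AL agree on the diagonal
   where the derivative of L is zero. *)
have QS : Q y * a t (y + r.+1)%N = a t y * Q y.+1.
  rewrite /Q -(@big_nat_recr _ _ _ r.+1 0 (fun j => a t (y + j)%N)) //=.
  rewrite big_ltn// addn0 big_add1 /=; congr (_ * _).
  by apply: eq_big_nat => j _; congr (a t); lia.
have := has_derivM (IH (y + 1)%N) (da y).
rewrite (rhsAE _ _ r0).
have -> : (r <= y + r.+1)%N by lia.
have -> : (y + r.+1 - r = y + 1)%N by lia.
have -> : (y + 1 + r.+1 = y + r.+1 + 1)%N by lia.
case: leqP => ry.
  move=> h2; have := has_derivD (IH (y - r)%N) h2.
  apply: has_deriv_ext => //; rewrite -/(Q y) -/(Q (y - r)%N) -/(Q (y + 1)%N).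
  have -> : (y - r + r.+1 = y + 1)%N by lia.
  rewrite [RHS]mulrDr (mulrCA (Q y) _ (a t _)) QS addn1; ring.
apply: has_deriv_ext => [s|]; rewrite ?add0r// -/(Q y) -/(Q (y + 1)%N).
rewrite [RHS]mulrDr (mulrCA (Q y) _ (a t _)) QS addn1; ring.
Qed.

(** A rise by [r] cannot end in a column below [r], so the last [j] steps of a path to column 0 are
    forced drops. *)
Lemma wpow_column0 (K : comPzRingType) (r : nat) (c : nat -> K) (x k j : nat) :
  (j <= r)%N ->
  wpow r 1 c x (k + j) 0 = \prod_(0 <= i < j) c i * wpow r 1 c x k j.
Proof.
elim: j k => [|j IH] k jr; first by rewrite addn0 big_geq// mul1r.
rewrite addnS -addSn IH/=; last lia.
rewrite leqNgt jr /= add0r addn1 big_nat_recr //=; ring.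
Qed.

(** In the moment of order [k + r.+1] the last [r] steps are forced drops from column [r]. The step
    into column [r] either drops from [r.+1], which gives the derivative, or rises from 0, which
    gives the term subtracted. *)
Lemma moment1_deriv (R : realType) (r : nat) (a : R -> nat -> R[i]) (t : R) (x k : nat) :
  (0 < r)%N -> (x <= r)%N ->
  (forall i, has_deriv_on0 (fun s => a s i) t (rhsA r (a t) i)) ->
  has_deriv_on0 (fun s => wpow r 1 (a s) x k 0) t
    (wpow r 1 (a t) x (k + r.+1) 0 - \prod_(0 <= i < r) a t i * wpow r 1 (a t) x k 0).
Proof.
move=> r0 xr da; apply: has_deriv_ext (has_deriv_moment1 k 0 r0 xr da) => //.
have -> : (k + r.+1 = k.+1 + r)%N by lia.
rewrite wpow_column0//= leqnn subnn big_nat_recr //= add0n addn1; ring.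
Qed.

(** This is the diagonal entry in place (y, y) of the power [q.+1] of L2: a closed path makes one
    drop, landing at one of these indices. *)
Definition window_sum (K : nmodType) (q : nat) (b : nat -> K) (y : nat) : K :=
  \sum_(0 <= j < q.+1) if (j <= y)%N then b (y - j)%N else 0.

Lemma window_sumS (K : zmodType) (q : nat) (b : nat -> K) (y : nat) :
  window_sum q b y.+1 = window_sum q b y + b y.+1 - if (q <= y)%N then b (y - q)%N else 0.
Proof.
rewrite /window_sum [LHS]big_ltn //= subn0 big_add1 /= [in RHS]big_nat_recr //=.
under [in LHS]eq_bigr do rewrite ltnS subSS.
by rewrite addrAC addrK addrC.
Qed.

Lemma rhsBE (R : realType) (q : nat) (b : nat -> R[i]) (i : nat) :
  rhsB q b i = b i * (window_sum q b (i + q) - window_sum q b i).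
Proof.
rewrite /rhsB; congr (_ * _).
have -> : window_sum q b (i + q) = \sum_(0 <= j < q.+1) b (i + j)%N.
  rewrite /window_sum big_nat_rev /=; apply: eq_big_nat => j jq.
  by rewrite (_ : (_ <= _)%N); [congr b; lia|lia].
rewrite /window_sum !(@big_ltn _ _ _ 0 q.+1) //=.
by rewrite addn0 subn0 opprD addrACA subrr add0r.
Qed.

(** From row 0 a drop by [q] is possible only after [q] rises, so the first [q] steps all rise. This
    also makes the normalising moments of the second system equal to 1. *)
Lemma wpow1q_small (K : pzRingType) (q : nat) (b : nat -> K) (j y : nat) :
  (j <= q)%N -> wpow 1 q b 0 j y = (y == j)%:R.
Proof.
elim: j y => [|j IH] y jq /=; first by rewrite eq_sym.
rewrite !IH; try lia.
rewrite (_ : (y + q == j)%N = false); last by apply/eqP; lia.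
rewrite mul0r addr0; case: y => [|y] //=.
by rewrite subn1.
Qed.

(** Row 0 of the Lax matrix A is zero, so only L^k A remains. A is the power [q.+1] of L2 without
    its diagonal, the [window_sum], and without its ones on superdiagonal [q.+1], which produce the
    last term. *)
Lemma has_deriv_moment2 (R : realType) (q : nat) (b : R -> nat -> R[i]) (t : R)
    (k y : nat) : (0 < q)%N ->
  (forall i, has_deriv_on0 (fun s => b s i) t (rhsB q (b t) i)) ->
  has_deriv_on0 (fun s => wpow 1 q (b s) 0 k y) t
    (wpow 1 q (b t) 0 (k + q.+1) y - window_sum q (b t) y * wpow 1 q (b t) 0 k y
     - if (q < y)%N then wpow 1 q (b t) 0 k (y - q.+1) else 0).
Proof.
move=> q0 db; elim: k y => [|k IH] y.
  rewrite add0n [wpow _ _ _ _ q.+1 _]/= !wpow1q_small//.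
  apply: has_deriv_ext (has_deriv_cst _ t) => [s /=|]; first by [].
  case: y => [|y] /=.
    rewrite add0n eqxx mul1r add0r mulr1 subr0 /window_sum big_ltn //= subn0.
    rewrite big1_seq ?addr0 ?subrr//.
    by move=> j; rewrite mem_index_iota andTb => /andP[j1 _]; rewrite leqNgt j1.
  rewrite subn1 /= (_ : (y.+1 + q == q)%N = false); last by apply/eqP; lia.
  rewrite mul0r mulr0 addr0 subr0 ltnS subSS.
  case: ltngtP => yq; rewrite ?subr0//; last by rewrite yq subnn eqxx subrr.
  by rewrite (_ : (_ == _) = false) ?subr0//; apply/eqP; lia.
have h2 := has_derivM (IH (y + q)%N) (db y).
rewrite addSn /=.
set wy := wpow 1 q (b t) 0 _ (y + q) in h2 *.
case: y @wy h2 => [|y] wy h2 /=.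
  apply: has_deriv_ext h2 => [s|]; first by rewrite add0r.
  rewrite rhsBE /wy add0n ltnn; ring.
have := has_derivD (IH y) h2; apply: has_deriv_ext => [s|]; first by rewrite subn1.
rewrite rhsBE (window_sumS q (b t) y).
have -> : (q < y.+1 + q)%N by lia.
have -> : (y.+1 + q - q.+1 = y)%N by lia.
have -> : (y.+1 - q.+1 = y - q)%N by lia.
have -> : (y.+1 - 1 = y)%N by lia.
rewrite ltnS.
have -> : (0 < y - q)%N = (q < y)%N by lia.
have -> : (y - q - 1 = y - q.+1)%N by lia.
have E (A : comNzRingType) (w w' u v D D' B c I : A) :
    w - D * v - I + ((w' - D' * u - v) * B + u * (B * (D' - (D + B - c)))) =
    w + w' * B - (D + B - c) * (v + u * B) - (I + v * c) by ring.
have [qy|yq] := leqP q y.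
  have -> : (y - q + q = y)%N by lia.
  exact: (E R[i]).
rewrite (_ : (q < y)%N = false); last lia.
(* For [y < q] no entry leaves the window, which is the identity [E] with [c = 0]; a zero product is
   inserted to match its shape. *)
rewrite -[X in _ = _ - X]addr0 -[X in _ = _ - (_ + X)](mulr0 (wpow 1 q (b t) 0 k y)).
exact: (E R[i]).
Qed.

Lemma moment2_deriv (R : realType) (q : nat) (b : R -> nat -> R[i]) (t : R)
    (k y : nat) : (0 < q)%N -> (y <= q)%N ->
  (forall i, has_deriv_on0 (fun s => b s i) t (rhsB q (b t) i)) ->
  has_deriv_on0 (fun s => wpow 1 q (b s) 0 k y) t
    (wpow 1 q (b t) 0 (k + q.+1) y - window_sum q (b t) y * wpow 1 q (b t) 0 k y).
Proof.
move=> q0 yq db; have := has_deriv_moment2 k y q0 db.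
by rewrite ltnNge yq /= subr0.
Qed.

(** * Moments and determinant formulas for an arbitrary solution *)

Lemma S1_tE (R : realType) (r : nat) (delta : R) (a0 : nat -> R[i])
    (a : R -> nat -> R[i]) (x k : nat) (t : R) :
  (0 < r)%N -> (x < r)%N -> is_solution (rhsA r) delta a0 a -> 0 <= t < delta ->
  S1_t r a0 x.+1 k t = wpow r 1 (a t) x k 0.
Proof.
move=> r0 xr [a0E sol] td.
rewrite (@normalized_moments R (fun k t => wpow r 1 (a t) x k 0)
  (fun k t => wpow r 1 (a t) 0 k 0) (fun t => \prod_(0 <= i < r) a t i) r.+1 0 delta).
- by rewrite /S1_t /S1_0 a0E; congr (expser _ _ / expser _ _); apply/funext => l;
    rewrite L1_powE ?add0n.
- move=> u /sol[_ [_ da]]; apply: has_deriv_prod => i.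
  by exists (rhsA r (a u) i); exact: da.
- by move=> j u /sol[_ [_ da]]; apply: moment1_deriv => //; exact: ltnW.
- by move=> j u /sol[_ [_ da]]; apply: moment1_deriv.
- move=> u /sol[/linftyP[M M0 aM] _]; exists M => // j.
  by split; exact: normc_wpow.
- by [].
- by [].
Qed.

(** The factor g now depends on the column [y], so each column is normalised by its own moment of
    order [y]; in the first system the same g serves all rows. *)
Lemma S2_tE (R : realType) (q : nat) (delta : R) (b0 : nat -> R[i])
    (b : R -> nat -> R[i]) (y k : nat) (t : R) :
  (0 < q)%N -> (y < q)%N -> is_solution (rhsB q) delta b0 b -> 0 <= t < delta ->
  S2_t q b0 y.+1 k t = wpow 1 q (b t) 0 k y.
Proof.
move=> q0 yq [b0E sol] td.
rewrite (@normalized_moments R (fun k t => wpow 1 q (b t) 0 k y)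
  (fun k t => wpow 1 q (b t) 0 k y) (fun t => window_sum q (b t) y) q.+1 y delta).
- by rewrite /S2_t /S2_0 b0E; congr (expser _ _ / expser _ _); apply/funext => l;
    rewrite L2_powE.
- move=> u /sol[_ [_ db]]; apply: has_deriv_sum => i.
  case: (i <= y)%N; first by exists (rhsB q (b u) (y - i)%N); exact: db.
  by exists 0; exact: has_deriv_cst.
- by move=> j u /sol[_ [_ db]]; apply: moment2_deriv => //; exact: ltnW.
- by move=> j u /sol[_ [_ db]]; apply: moment2_deriv => //; exact: ltnW.
- move=> u /sol[/linftyP[M M0 bM] _]; exists M => // j.
  by split; exact: normc_wpow.
- by move=> u _; rewrite wpow1q_small ?eqxx//; exact: ltnW.
- by [].
Qed.

(** The determinants are products of p_j = a_0 ... a_(j-1), so the quotient equals p_(i+1) / p_i. *)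
Lemma solutionA_formula (R : realType) (r : nat) (delta : R) (a0 : nat -> R[i])
    (a : R -> nat -> R[i]) (i : nat) (t : R) :
  (0 < r)%N -> is_solution (rhsA r) delta a0 a -> 0 <= t < delta ->
  a t i = D1 r a0 i.+2 t * D1 r a0 i t / (D1 r a0 i.+1 t) ^+ 2.
Proof.
move=> r0 sol td; have [_ [an0 _]] := sol.2 t td.
have DE n : D1 r a0 n t = \prod_(j < n) \prod_(l < j) a t l.
  rewrite -(det_moments1 _ _ r0) /D1; congr (\det _); apply/matrixP => l j; rewrite !mxE.
  by apply: (S1_tE _ r0 _ sol td); rewrite ltn_mod.
rewrite !DE !(big_ord_recr i.+1) !(big_ord_recr i) /=.
set P := \prod_(j < i) _; set p := \prod_(l < i) _.
have P0 : P != 0 by apply/prodf_neq0 => j _; apply/prodf_neq0 => l _; exact: an0.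
have p0 : p != 0 by apply/prodf_neq0 => l _; exact: an0.
suff E (K : fieldType) (u v c : K) : u != 0 -> v != 0 ->
    c = u * v * (v * c) * u / (u * v) ^+ 2 by exact: (E R[i]).
by move=> u0 v0; field; rewrite u0 v0.
Qed.

(** The quotient equals [p (i + q) / p i]: indices [i] and [i + q] have the same residue, and the
    longer product gains the single factor [b t i]. *)
Lemma solutionB_formula (R : realType) (q : nat) (delta : R) (b0 : nat -> R[i])
    (b : R -> nat -> R[i]) (i : nat) (t : R) :
  (0 < q)%N -> is_solution (rhsB q) delta b0 b -> 0 <= t < delta ->
  b t i = D2 q b0 (i + q).+1 t * D2 q b0 i t
          / (D2 q b0 (i + q) t * D2 q b0 i.+1 t).
Proof.
move=> q0 sol td; have [_ [bn0 _]] := sol.2 t td.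
pose p j := \prod_(l < j %/ q) b t (j %% q + q * l)%N.
have p0 j : p j != 0 by apply/prodf_neq0 => l _; exact: bn0.
have DE n : D2 q b0 n t = \prod_(j < n) p j.
  rewrite -(det_moments2 _ _ q0) /D2; congr (\det _); apply/matrixP => l j; rewrite !mxE.
  by apply: (S2_tE _ q0 _ sol td); rewrite ltn_mod.
have pS : p (i + q)%N = p i * b t i.
  rewrite /p divnDr ?dvdnn// divnn q0 addn1 big_ord_recr /= modnDr.
  by rewrite [in b t (_ + _)%N]addnC mulnC -divn_eq.
have P0 n : \prod_(j < n) p j != 0 by apply/prodf_neq0 => j _; exact: p0.
rewrite !DE !(big_ord_recr (i + q)%N) !(big_ord_recr i) /= pS.
suff E (K : fieldType) (u v w c : K) : u != 0 -> v != 0 -> w != 0 ->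
    c = u * (w * c) * v / (u * (v * w)).
  exact: (E R[i] _ _ _ _ (P0 _) (P0 _) (p0 _)).
by move=> u0 v0 w0; field; rewrite u0 v0 w0.
Qed.

(** * Local existence *)

Lemma real_mean_value (R : realType) (g g' : R -> R) (T s t D : R) :
  0 <= s -> s <= t -> t <= T -> {within `[0, T], continuous g} ->
  (forall x, s < x < t -> is_derive x 1 g (g' x)) ->
  (forall x, s <= x <= t -> `|g' x| <= D) ->
  `|g t - g s| <= D * (t - s).
Proof.
move=> s0 st tT gc dg gD.
have dg' x : x \in `]s, t[ -> is_derive x 1 g (g' x).
  by rewrite in_itv /=; exact: dg.
have gc' : {within `[s, t], continuous g}.
  by apply: continuous_subspaceW gc => x /=; rewrite !in_itv /=; lra.
have [x xst e] := MVT_segment st dg' gc'.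
rewrite e normrM [`|t - s|]ger0_norm ?subr_ge0// ler_wpM2r ?subr_ge0//.
exact: gD.
Qed.

(** The factor 2 comes from estimating real and imaginary parts separately. *)
Lemma complex_mean_value (R : realType) (f f' : R -> R[i]) (delta s t D : R) :
  0 <= s -> s <= t -> t < delta ->
  (forall x, 0 <= x < delta -> has_deriv_on0 f x (f' x)) ->
  (forall x, s <= x <= t -> normc (f' x) <= D) ->
  normc (f t - f s) <= 2 * D * (t - s).
Proof.
move=> s0 st td df fD; pose T := (t + delta) / 2.
have T0 : 0 < T by rewrite /T; lra.
have hr x : 0 < x <= T -> is_derive x 1 (@complex.Re R \o f) (complex.Re (f' x)).
  move=> xT; apply: is_derive_Re; first by rewrite gt_eqF; lra.
  by apply: df; rewrite /T in xT; lra.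
have hi x : 0 < x <= T -> is_derive x 1 (@complex.Im R \o f) (complex.Im (f' x)).
  move=> xT; apply: is_derive_Im; first by rewrite gt_eqF; lra.
  by apply: df; rewrite /T in xT; lra.
have cr : {within `[0, T], continuous (@complex.Re R \o f)}.
  apply: (within_continuous_of_deriv T0 _ hr).
  by apply: has_deriv_cvg_right (df 0 _); [exact: Re_dist|lra].
have ci : {within `[0, T], continuous (@complex.Im R \o f)}.
  apply: (within_continuous_of_deriv T0 _ hi).
  by apply: has_deriv_cvg_right (df 0 _); [exact: Im_dist|lra].
have tT : t <= T by rewrite /T; lra.
have Er : `|complex.Re (f t) - complex.Re (f s)| <= D * (t - s).
  apply: (real_mean_value s0 st tT cr (g' := @complex.Re R \o f')) => x xst.
    by apply: hr; lra.
  by apply: le_trans (fD x xst); exact: Re_le_normc.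
have Ei : `|complex.Im (f t) - complex.Im (f s)| <= D * (t - s).
  apply: (real_mean_value s0 st tT ci (g' := @complex.Im R \o f')) => x xst.
    by apply: hi; lra.
  by apply: le_trans (fD x xst); exact: Im_le_normc.
apply: le_trans (normc_le_ReIm _) _.
rewrite !(complex_ReD, complex_ImD, complex_ReN, complex_ImN).
lra.
Qed.

Lemma has_deriv_real_complex (R : realType) (t : R) :
  has_deriv_on0 (fun s : R => s%:C) t 1.
Proof.
by apply: has_deriv_of_parts => /=; first [exact: is_derive_id|exact: is_derive_cst].
Qed.

Lemma has_deriv_horner (R : realType) (p : {poly R[i]}) (t : R) :
  has_deriv_on0 (fun s => p.[s%:C]) t (p^`()).[t%:C].
Proof.
elim/poly_ind: p => [|p c IH].
  by apply: has_deriv_ext (has_deriv_cst 0 t) => [s|]; rewrite ?deriv0 horner0.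
have := has_derivD (has_derivM IH (has_deriv_real_complex t)) (has_deriv_cst c t).
apply: has_deriv_ext => [s|]; first by rewrite hornerMXaddC.
by rewrite derivMXaddC hornerD hornerMX addr0 mulr1 addrC.
Qed.

Definition poly_primitive (K : fieldType) (p : {poly K}) : {poly K} :=
  (\poly_(i < size p) (p`_i / i.+1%:R)) * 'X.

Lemma deriv_poly_primitive (K : numFieldType) (p : {poly K}) :
  (poly_primitive p)^`() = p.
Proof.
apply/polyP => i; rewrite coef_deriv coefMX /= coef_poly; case: ltnP => ip.
  by rewrite -[LHS]mulr_natr divfK// pnatr_eq0.
by rewrite mul0rn nth_default.
Qed.

Lemma horner0_poly_primitive (K : fieldType) (p : {poly K}) :
  (poly_primitive p).[0] = 0.
Proof. by rewrite hornerMX mulr0. Qed.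

Lemma le_geometric_limit (R : realType) (x y A : R) :
  0 <= A -> (forall n : nat, x <= y + A / 2 ^+ n) -> x <= y.
Proof.
move=> A0 h; apply/ler_addgt0Pr => e e0.
pose n := (Num.truncn (A / e)).+1.
have An : A / e < n%:R by exact: truncnS_gt.
apply: le_trans (h n) _; rewrite lerD2l ler_pdivrMr ?exprn_gt0//.
rewrite mulrC -ler_pdivrMr//; apply: le_trans (ltW An) _.
by rewrite -natrX ler_nat; apply: ltnW; exact: ltn_expl.
Qed.

Lemma geometric_cauchy_real (R : realType) (x : nat -> R) (M : R) : 0 <= M ->
  (forall n, `|x n.+1 - x n| <= M / 2 ^+ n) ->
  exists l, forall n, `|l - x n| <= 2 * M / 2 ^+ n.
Proof.
move=> M0 xM.
(* The sum of all step bounds from [n] on; the intervals of radius [e n] around [x n] are therefore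
   nested, and the supremum of their left ends lies in each. *)
pose e n : R := 2 * M / 2 ^+ n.
have e0 n : 0 <= e n by rewrite divr_ge0 ?exprn_ge0 ?mulr_ge0.
have eS n : e n.+1 = M / 2 ^+ n.
  by rewrite /e exprS; field; rewrite expf_neq0.
have eSS n : e n = M / 2 ^+ n + M / 2 ^+ n by rewrite /e; ring.
have lo m n : (m <= n)%N -> x m - e m <= x n - e n.
  move=> /subnK <-; elim: (n - m)%N => [|k IH]; first by rewrite add0n.
  apply: le_trans IH _; rewrite addSn.
  by have := xM (k + m)%N; rewrite ler_norml eS eSS; lra.
have hi m n : (m <= n)%N -> x n + e n <= x m + e m.
  move=> /subnK <-; elim: (n - m)%N => [|k IH]; first by rewrite add0n.
  apply: le_trans _ IH; rewrite addSn.
  by have := xM (k + m)%N; rewrite ler_norml eS eSS; lra.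
pose A := [set x n - e n | n in setT].
have Aub n : ubound A (x n + e n).
  move=> _ [m _ <-]; have := lo m _ (leq_maxl m n); have := hi n _ (leq_maxr m n).
  by have := e0 (maxn m n); lra.
exists (sup A) => n; rewrite -/(e n) ler_distl; apply/andP; split.
  by apply: ub_le_sup; [exists (x n + e n); exact: Aub|exists n].
by apply: ge_sup; [exists (x n - e n), n|exact: Aub].
Qed.

Lemma geometric_cauchy_complex (R : realType) (z : nat -> R[i]) (M : R) : 0 <= M ->
  (forall n, normc (z n.+1 - z n) <= M / 2 ^+ n) ->
  exists l, forall n, normc (l - z n) <= 4 * M / 2 ^+ n.
Proof.
move=> M0 zM.
have [|lr hr] := @geometric_cauchy_real R (@complex.Re R \o z) M M0.
  by move=> n; apply: le_trans (zM n); exact: Re_dist.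
have [|li hi] := @geometric_cauchy_real R (@complex.Im R \o z) M M0.
  by move=> n; apply: le_trans (zM n); exact: Im_dist.
exists (lr +i* li) => n; apply: le_trans (normc_le_ReIm _) _.
rewrite !(complex_ReD, complex_ImD, complex_ReN, complex_ImN).
have := hr n; have := hi n => /=; rewrite -![_ * M / _]mulrA.
set q := M / _; lra.
Qed.

Definition locally_lipschitz (R : realType) (F : (nat -> R[i]) -> nat -> R[i]) :=
  forall B : R, 0 <= B -> exists2 Lam : R, 0 <= Lam &
    forall (u v : nat -> R[i]) (e : R), 0 <= e ->
      (forall j, normc (u j) <= B) -> (forall j, normc (v j) <= B) ->
      (forall j, normc (u j - v j) <= e) -> forall i, normc (F u i - F v i) <= Lam * e.

(** [FP] is the vector field acting on polynomials in time, so each iterate is integrated formally,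
    coefficient by coefficient. *)
Fixpoint picard (K : fieldType) (FP : (nat -> {poly K}) -> nat -> {poly K})
    (u0 : nat -> K) (n : nat) : nat -> {poly K} :=
  if n is n'.+1 then fun i => (u0 i)%:P + poly_primitive (FP (picard FP u0 n') i)
  else fun i => (u0 i)%:P.

Lemma normc_distC (R : realType) (z w : R[i]) : normc (z - w) = normc (w - z).
Proof. by rewrite -normcN opprB. Qed.

(** A quadratic estimate survives passage to the limit, so the limit of the Picard iterates is
    differentiated without interchanging limit and derivative. *)
Lemma has_deriv_of_quadratic (R : realType) (u : R -> R[i]) (l : R[i])
    (delta C t : R) : 0 <= t < delta -> 0 <= C ->
  (forall t', 0 <= t' < delta ->
     normc (u t' - u t - (t' - t)%:C * l) <= C * (t' - t) ^+ 2) ->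
  has_deriv_on0 u t l.
Proof.
move=> td C0 uC; rewrite has_derivE; apply/cvg_complexP => e e0.
pose m := Num.min (e / (C + 1)) (delta - t).
have m0 : 0 < m by rewrite lt_min divr_gt0//; lra.
have me : m <= e / (C + 1) by rewrite ge_min lexx.
have md : m <= delta - t by rewrite ge_min lexx orbT.
have inD : \forall h \near dfilter t, 0 <= t + h.
  rewrite /dfilter; case: eqP => [->|/eqP t0].
    by exists 1 => //= h _ h0; rewrite add0r ltW.
  have t0' : 0 < t by rewrite lt_def t0; lra.
  exists t => //= h; rewrite /ball_ /= sub0r normrN ltr_norml => ht _; lra.
near=> h.
have hn0 : h != 0 by near: h; exact: dfilter_neq0.
have ht : 0 <= t + h by near: h.
have hm : `|h| <= m / 2 by near: h; apply: dfilter_small; rewrite divr_gt0.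
have he : `|h| <= e / (C + 1) by lra.
have hd : `|h| < delta - t by lra.
have hC : h%:C != 0 :> R[i] by rewrite fmorph_eq0.
have -> : l - (h%:C)^-1 * (u (t + h) - u t) =
    (h%:C)^-1 * (h%:C * l - (u (t + h) - u t)) by rewrite [RHS]mulrBr mulKf.
have H : normc (h%:C * l - (u (t + h) - u t)) <= C * h ^+ 2.
  have thE : t + h - t = h by lra.
  rewrite normc_distC; have := uC (t + h); rewrite thE; apply.
  by have := ler_norm h; lra.
rewrite normcM normcV.
have -> : normc h%:C = `|h| by rewrite /normc /= expr0n /= addr0 sqrtr_sqr.
have nh : 0 < `|h| by rewrite normr_gt0.
rewrite ler_pdivrMl//; apply: le_trans H _.
rewrite -(real_normK (num_real h)) expr2 mulrA mulrC ler_wpM2l//.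
have : C * `|h| <= C * (e / (C + 1)) by rewrite ler_wpM2l.
have : C * (e / (C + 1)) <= e.
  by rewrite mulrA ler_pdivrMr; lra.
lra.
Unshelve. all: by end_near. Qed.

Lemma picard_local_existence (R : realType) (F : (nat -> R[i]) -> nat -> R[i])
    (FP : (nat -> {poly R[i]}) -> nat -> {poly R[i]}) (u0 : nat -> R[i]) :
  (forall p i z, (FP p i).[z] = F (fun j => (p j).[z]) i) ->
  locally_lipschitz F -> (forall i, F (fun=> 0) i = 0) -> linfty u0 ->
  exists2 delta : R, 0 < delta & exists u : R -> nat -> R[i], u 0 = u0 /\
    forall t, 0 <= t < delta -> linfty (u t) /\
      forall i, has_deriv_on0 (fun s => u s i) t (F (u t) i).
Proof.
move=> FPE Flip F0 /linftyP[M' M'0 u0M'].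
pose M := M' + 1; have M0 : 0 < M by rewrite /M; lra.
have u0M j : normc (u0 j) <= M by apply: le_trans (u0M' j) _; rewrite /M; lra.
(* The limit will differ from [u0] by at most [4 * M], so the iterates and the limit stay in this
   ball, where the Lipschitz constant is taken. *)
pose B := 5 * M.
have [Lam Lam0 FL] := Flip B ltac:(rewrite /B; lra).
(* The mean value factor 2 and the 5 in [B] make 10: within time [delta] an iterate moves by at most
   [M]. The same choice leaves ample room for halving successive differences. *)
pose delta := (10 * (Lam + 1))^-1.
have dE : 10 * delta * (Lam + 1) = 1 by rewrite /delta; field; lra.
have d0 : 0 < delta by rewrite invr_gt0; lra.
have dL : 10 * delta * Lam <= 1 by rewrite mulrDr mulr1 in dE; lra.
have dLM : 10 * delta * Lam * M <= M by rewrite ler_piMl// ltW.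
have FB u : (forall j, normc (u j) <= B) -> forall i, normc (F u i) <= Lam * B.
  move=> uB i; have := FL u (fun=> 0) B _ uB _ _ i; rewrite F0 subr0; apply.
  - by rewrite /B; lra.
  - by move=> j; rewrite normc0 /B; lra.
  - by move=> j; rewrite subr0.
pose p n i t := (picard FP u0 n i).[t%:C].
pose dp n i t := ((picard FP u0 n i)^`()).[t%:C].
have p_deriv n i t : has_deriv_on0 (p n i) t (dp n i t) by exact: has_deriv_horner.
have dpS n i t : dp n.+1 i t = F (fun j => p n j t) i.
  by rewrite /dp /= derivD derivC add0r deriv_poly_primitive FPE.
have dp0 i t : dp 0%N i t = 0 by rewrite /dp /= derivC horner0.
have p_0 n i : p n i 0 = u0 i.
  by case: n => [|n]; rewrite /p /= ?hornerD hornerC// horner0_poly_primitive addr0.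
have ltd t : 0 <= t <= delta -> t < delta + 1 by lra.
have pB n : forall i t, 0 <= t <= delta -> normc (p n i t) <= 2 * M.
  elim: n => [|n IH] i t td.
    by rewrite /p /= hornerC; apply: le_trans (u0M i) _; lra.
  have : normc (p n.+1 i t - p n.+1 i 0) <= 2 * (Lam * B) * (t - 0).
    (* The iterates are polynomials, differentiable at all times; [delta + 1] makes room for the end
       point [t = delta]. *)
    apply: (@complex_mean_value _ _ (dp n.+1 i) (delta + 1)); try lra.
      by move=> x _; exact: p_deriv.
    move=> x xt; rewrite dpS; apply: FB => j.
    by apply: le_trans (IH j x _) _; rewrite /B; lra.
  rewrite subr0 p_0 => h.
  have : normc (p n.+1 i t) <= normc (p n.+1 i t - u0 i) + normc (u0 i).
    by apply: le_trans (normc_triangle _ _); rewrite subrK.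
  have : 2 * (Lam * B) * t <= 2 * (Lam * B) * delta.
    by rewrite ler_wpM2l ?mulr_ge0//; rewrite /B; lra.
  have := u0M i; move: h; rewrite /B; lra.
have pB' n i t : 0 <= t <= delta -> normc (p n i t) <= B.
  by move=> td; apply: le_trans (pB n i t td) _; rewrite /B; lra.
have pC n : forall i t, 0 <= t <= delta ->
    normc (p n.+1 i t - p n i t) <= M / 2 ^+ n.
  elim: n => [|n IH] i t td.
    have -> : p 0%N i t = p 1%N i 0 by rewrite p_0 /p /= hornerC.
    have : normc (p 1%N i t - p 1%N i 0) <= 2 * (Lam * B) * (t - 0).
      apply: (@complex_mean_value _ _ (dp 1%N i) (delta + 1)); try lra.
        by move=> x _; exact: p_deriv.
      by move=> x xt; rewrite dpS; apply: FB => j; apply: pB'; lra.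
    have : 2 * (Lam * B) * t <= 2 * (Lam * B) * delta.
      by rewrite ler_wpM2l ?mulr_ge0//; rewrite /B; lra.
    rewrite expr0 divr1 subr0 /B; lra.
  have E0 : p n.+2 i 0 - p n.+1 i 0 = 0 by rewrite !p_0 subrr.
  have : normc ((p n.+2 i t - p n.+1 i t) - (p n.+2 i 0 - p n.+1 i 0))
      <= 2 * (Lam * (M / 2 ^+ n)) * (t - 0).
    apply: (@complex_mean_value _ (fun x => p n.+2 i x - p n.+1 i x)
      (fun x => dp n.+2 i x - dp n.+1 i x) (delta + 1)); try lra.
      by move=> x _; apply: has_derivD (p_deriv _ _ _) (has_derivN (p_deriv _ _ _)).
    move=> x xt; rewrite !dpS; apply: FL => [|j|j|j].
    - by rewrite divr_ge0 ?exprn_ge0// ltW.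
    - by apply: pB'; lra.
    - by apply: pB'; lra.
    - by apply: IH; lra.
  rewrite E0 !subr0 => h; apply: le_trans h _.
  have q0 : 0 <= M / 2 ^+ n by rewrite divr_ge0 ?exprn_ge0// ltW.
  have -> : M / 2 ^+ n.+1 = M / 2 ^+ n / 2.
    by rewrite exprS; field; rewrite expf_neq0.
  set Q := M / 2 ^+ n in q0 *.
  have : 2 * (Lam * Q) * t <= 2 * (Lam * Q) * delta.
    by rewrite ler_wpM2l ?mulr_ge0//; lra.
  have : 10 * delta * Lam * Q <= Q by rewrite ler_piMl.
  lra.
have lim_ex (t : R) (i : nat) : exists l : R[i], 0 <= t <= delta ->
    forall n, normc (l - p n i t) <= 4 * M / 2 ^+ n.
  have [td|ntd] := boolP (0 <= t <= delta); last by exists 0.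
  have [l hl] := geometric_cauchy_complex (ltW M0) (fun n => pC n i t td).
  by exists l.
pose u t i := sval (cid (lim_ex t i)).
have up t i n : 0 <= t <= delta -> normc (u t i - p n i t) <= 4 * M / 2 ^+ n.
  by move=> td; exact: (svalP (cid (lim_ex t i))).
have uB t i : 0 <= t <= delta -> normc (u t i) <= B.
  move=> td; have := up t i 0%N td; rewrite expr0 divr1 /p /= hornerC => h.
  have : normc (u t i) <= normc (u t i - u0 i) + normc (u0 i).
    by apply: le_trans (normc_triangle _ _); rewrite subrK.
  by have := u0M i; rewrite /B; lra.
exists delta => //; exists u; split.
  apply/funext => i; apply/eqP; rewrite -subr_eq0; apply/eqP/eq0_normc.
  apply/eqP; rewrite eq_le normc_ge0 andbT.
  apply: (@le_geometric_limit _ _ 0 (4 * M)); first lra.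
  by move=> n; have := up 0 i n; rewrite p_0 add0r; apply; lra.
move=> t td; split.
  by exists B => i; rewrite normr_complexE lecR; apply: uB; lra.
(* The iterates move at speed at most [Lam * B]. Two mean value factors 2 and the Lipschitz
   constant, applied to the next derivative, give [C], independent of [n]. *)
move=> i; pose C := 4 * Lam ^+ 2 * B.
have C0 : 0 <= C by rewrite /C /B !mulr_ge0 ?exprn_ge0//; lra.
have pquad n t' : 0 <= t' < delta ->
    normc (p n.+1 i t' - p n.+1 i t - (t' - t)%:C * F (fun j => p n j t) i)
      <= C * (t' - t) ^+ 2.
  move=> t'd.
  have plip x y j : 0 <= x -> x <= y -> y <= delta ->
      normc (p n j y - p n j x) <= 2 * (Lam * B) * (y - x).
    move=> x0 xy yd; apply: (@complex_mean_value _ _ (dp n j) (delta + 1)); try lra.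
      by move=> z _; exact: p_deriv.
    move=> z zxy; case: (n) => [|m].
      by rewrite dp0 normc0 mulr_ge0// /B; lra.
    by rewrite dpS; apply: FB => l; apply: pB'; lra.
  pose c := F (fun j => p n j t) i.
  pose g x := p n.+1 i x - x%:C * c.
  have g_deriv x : has_deriv_on0 g x (dp n.+1 i x - c).
    apply: has_deriv_ext (has_derivD (p_deriv n.+1 i x)
      (has_derivN (has_derivM (has_deriv_real_complex x) (has_deriv_cst c x)))) => //.
    by rewrite mulr0 addr0 mul1r.
  have gE : p n.+1 i t' - p n.+1 i t - (t' - t)%:C * c = g t' - g t.
    by rewrite /g rmorphB; ring.
  rewrite gE.
  have plip' x : 0 <= x <= delta -> `|x - t| <= `|t' - t| ->
      normc (dp n.+1 i x - c) <= Lam * (2 * (Lam * B) * `|t' - t|).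
    move=> xd xt; rewrite dpS /c.
    have LB0 : 0 <= 2 * (Lam * B) by rewrite !mulr_ge0// /B; lra.
    apply: FL => [|j|j|j].
    - by rewrite mulr_ge0.
    - by apply: pB'; lra.
    - by apply: pB'; lra.
    - apply: (@le_trans _ _ (2 * (Lam * B) * `|x - t|)); last by rewrite ler_wpM2l.
      have [tx|xt'] := leP t x.
        by rewrite ger0_norm ?subr_ge0//; apply: plip; lra.
      by rewrite normc_distC ltr0_norm ?opprB; [apply: plip|]; lra.
  have [tt'|t't] := leP t t'.
    apply: le_trans (_ : 2 * (Lam * (2 * (Lam * B) * `|t' - t|)) * (t' - t) <= _).
      apply: (@complex_mean_value _ _ (fun x => dp n.+1 i x - c) (delta + 1)); try lra.
        by move=> x _; exact: g_deriv.
      by move=> x xt; apply: plip'; [lra|rewrite !ger0_norm; lra].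
    by rewrite ger0_norm ?subr_ge0// /C le_eqVlt; apply/orP; left; apply/eqP; ring.
  rewrite normc_distC.
  apply: le_trans (_ : 2 * (Lam * (2 * (Lam * B) * `|t' - t|)) * (t - t') <= _).
    apply: (@complex_mean_value _ _ (fun x => dp n.+1 i x - c) (delta + 1)); try lra.
      by move=> x _; exact: g_deriv.
    by move=> x xt; apply: plip'; [lra|rewrite !ler0_norm; lra].
  rewrite ltr0_norm ?subr_lt0// /C le_eqVlt; apply/orP; left; apply/eqP; ring.
apply: (@has_deriv_of_quadratic _ _ _ delta C) => // t' t'd.
(* Replacing the iterate by the limit costs one error at each of [t] and [t'], hence the 2, and one
   in the value of [F], scaled by the time step and [Lam]. *)
apply: (@le_geometric_limit _ _ _ (4 * M * (2 + `|t' - t| * Lam))).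
  by rewrite mulr_ge0 ?addr_ge0 ?mulr_ge0//; lra.
move=> n.
have k1 := up t' i n.+1 ltac:(lra); have k2 := up t i n.+1 ltac:(lra).
have Q0 : 0 <= 4 * M / 2 ^+ n by rewrite divr_ge0 ?exprn_ge0//; lra.
have QS : 4 * M / 2 ^+ n.+1 <= 4 * M / 2 ^+ n.
  rewrite ler_wpM2l//; first lra.
  by rewrite lef_pV2 ?posrE ?exprn_gt0// ler_weXn2l// ler1n.
have k3 : normc (F (fun j => p n j t) i - F (u t) i) <= Lam * (4 * M / 2 ^+ n).
  apply: FL => // j.
  - by apply: pB'; lra.
  - by apply: uB; lra.
  - by rewrite normc_distC; apply: up; lra.
have k4 := pquad n t' t'd.
set c := F (fun j => p n j t) i in k3 k4; set c' := F (u t) i in k3 *.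
have -> : u t' i - u t i - (t' - t)%:C * c' =
  (p n.+1 i t' - p n.+1 i t - (t' - t)%:C * c) +
  ((u t' i - p n.+1 i t') + ((p n.+1 i t - u t i) + (t' - t)%:C * (c - c'))) by ring.
apply: le_trans (normc_triangle _ _) _; apply: lerD => //.
apply: le_trans (normc_triangle _ _) _.
have -> : 4 * M * (2 + `|t' - t| * Lam) / 2 ^+ n =
  4 * M / 2 ^+ n + (4 * M / 2 ^+ n + `|t' - t| * (Lam * (4 * M / 2 ^+ n))).
  by field; rewrite expf_neq0.
apply: lerD; first exact: le_trans k1 QS.
apply: le_trans (normc_triangle _ _) _; apply: lerD.
  by rewrite normc_distC; exact: le_trans k2 QS.
rewrite normcM ler_pM ?normc_ge0//.
by rewrite /normc /= expr0n /= addr0 sqrtr_sqr.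
Qed.

(** * Lipschitz estimates for polynomial vector fields on bounded sequences *)

Definition bounded_lipschitz (R : realType) (B : R)
    (phi : nat -> (nat -> R[i]) -> R[i]) :=
  exists Lam N : R, [/\ 0 <= Lam, 0 <= N,
    forall i u, (forall j, normc (u j) <= B) -> normc (phi i u) <= N &
    forall i (u v : nat -> R[i]) (e : R), 0 <= e ->
      (forall j, normc (u j) <= B) -> (forall j, normc (v j) <= B) ->
      (forall j, normc (u j - v j) <= e) -> normc (phi i u - phi i v) <= Lam * e].

Lemma bounded_lipschitz_cst (R : realType) (B : R) (c : R[i]) :
  bounded_lipschitz B (fun _ _ => c).
Proof.
exists 0, (normc c); split => //; first exact: normc_ge0.
by move=> i u v e e0 _ _ _; rewrite subrr normc0 mul0r.
Qed.

(** The value [None] encodes a negative index, whose coordinate is 0 by convention. *)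
Lemma bounded_lipschitz_proj (R : realType) (B : R) (sigma : nat -> option nat) :
  0 <= B ->
  bounded_lipschitz B (fun i u => if sigma i is Some j then u j else 0).
Proof.
move=> B0; exists 1, B; split => //.
  by move=> i u uB; case: (sigma i) => [j|]; rewrite ?normc0.
move=> i u v e e0 _ _ uv; rewrite mul1r.
by case: (sigma i) => [j|]; rewrite ?subrr ?normc0.
Qed.

Lemma bounded_lipschitzD (R : realType) (B : R) phi psi :
  @bounded_lipschitz R B phi -> bounded_lipschitz B psi ->
  bounded_lipschitz B (fun i u => phi i u + psi i u).
Proof.
move=> [L [N [L0 N0 bN lL]]] [L' [N' [L'0 N'0 bN' lL']]].
exists (L + L'), (N + N'); split; rewrite ?addr_ge0//.
  by move=> i u uB; apply: le_trans (normc_triangle _ _) _; rewrite lerD ?bN ?bN'.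
move=> i u v e e0 uB vB uv; rewrite opprD addrACA mulrDl.
by apply: le_trans (normc_triangle _ _) _; rewrite lerD ?lL ?lL'.
Qed.

(** This is why [bounded_lipschitz] carries a bound: the difference of products is controlled by
    each Lipschitz constant times the bound on the other factor. *)
Lemma bounded_lipschitzM (R : realType) (B : R) phi psi :
  @bounded_lipschitz R B phi -> bounded_lipschitz B psi ->
  bounded_lipschitz B (fun i u => phi i u * psi i u).
Proof.
move=> [L [N [L0 N0 bN lL]]] [L' [N' [L'0 N'0 bN' lL']]].
exists (L * N' + N * L'), (N * N'); split; rewrite ?addr_ge0 ?mulr_ge0//.
  by move=> i u uB; rewrite normcM ler_pM ?normc_ge0 ?bN ?bN'.
move=> i u v e e0 uB vB uv.
have -> : phi i u * psi i u - phi i v * psi i v =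
  (phi i u - phi i v) * psi i u + phi i v * (psi i u - psi i v) by ring.
apply: le_trans (normc_triangle _ _) _; rewrite !normcM mulrDl.
have -> : L * N' * e = L * e * N' by ring.
rewrite -[N * L' * e]mulrA.
by apply: lerD; apply: ler_pM; rewrite ?normc_ge0 ?bN ?bN' ?lL ?lL'.
Qed.

Lemma bounded_lipschitzN (R : realType) (B : R) phi :
  @bounded_lipschitz R B phi -> bounded_lipschitz B (fun i u => - phi i u).
Proof.
move=> h; have := bounded_lipschitzM (bounded_lipschitz_cst B (-1)) h.
by congr bounded_lipschitz; apply/funext => i; apply/funext => u; rewrite mulN1r.
Qed.

Lemma bounded_lipschitz_prod (R : realType) (B : R) (s : seq nat) phi :
  (forall j, @bounded_lipschitz R B (phi j)) ->
  bounded_lipschitz B (fun i u => \prod_(j <- s) phi j i u).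
Proof.
move=> h; elim: s => [|j s IH].
  have := bounded_lipschitz_cst B 1; congr bounded_lipschitz.
  by apply/funext => i; apply/funext => u; rewrite big_nil.
have := bounded_lipschitzM (h j) IH; congr bounded_lipschitz.
by apply/funext => i; apply/funext => u; rewrite big_cons.
Qed.

Lemma bounded_lipschitz_sum (R : realType) (B : R) (s : seq nat) phi :
  (forall j, @bounded_lipschitz R B (phi j)) ->
  bounded_lipschitz B (fun i u => \sum_(j <- s) phi j i u).
Proof.
move=> h; elim: s => [|j s IH].
  have := bounded_lipschitz_cst B 0; congr bounded_lipschitz.
  by apply/funext => i; apply/funext => u; rewrite big_nil.
have := bounded_lipschitzD (h j) IH; congr bounded_lipschitz.
by apply/funext => i; apply/funext => u; rewrite big_cons.
Qed.

Lemma bounded_lipschitz_shift (R : realType) (B : R) (k : nat) : 0 <= B ->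
  bounded_lipschitz B (fun i (u : nat -> R[i]) => u (i + k)%N).
Proof. by move=> B0; apply: (bounded_lipschitz_proj (fun i => Some (i + k)%N)). Qed.

Lemma bounded_lipschitz_unshift (R : realType) (B : R) (k : nat) : 0 <= B ->
  bounded_lipschitz B
    (fun i (u : nat -> R[i]) => if (k <= i)%N then u (i - k)%N else 0).
Proof.
move=> B0; have := bounded_lipschitz_proj
  (fun i => if (k <= i)%N then Some (i - k)%N else None) B0.
congr bounded_lipschitz; apply/funext => i; apply/funext => u.
by case: leqP.
Qed.

Lemma bounded_lipschitz_locally (R : realType) (F : (nat -> R[i]) -> nat -> R[i]) :
  (forall B, 0 <= B -> bounded_lipschitz B (fun i u => F u i)) ->
  locally_lipschitz F.
Proof.
move=> h B /h[Lam [N [L0 _ _ lL]]]; exists Lam => // u v e e0 uB vB uv i.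
exact: lL.
Qed.

(* Multiplied by an integrating factor of -G, a solution of u' = u G is constant. *)
Lemma linear_ode_neq0 (R : realType) (u G : R -> R[i]) (delta : R) :
  (forall t, 0 <= t < delta -> exists l, has_deriv_on0 G t l) ->
  (forall t, 0 <= t < delta -> has_deriv_on0 u t (u t * G t)) -> u 0 != 0 ->
  forall t, 0 <= t < delta -> u t != 0.
Proof.
move=> dG du u0 t td.
have dG0 s : exists l, 0 <= s < delta -> has_deriv_on0 (fun x => - G x) s l.
  have [/dG[l Gl]|sd] := boolP (0 <= s < delta); last by exists 0.
  by exists (- l) => _; exact: has_derivN.
have [G' dG'] := boolp.choice dG0.
have Td : 0 < (t + delta) / 2 < delta by lra.
have [tau [tau0 tauN0 dtau]] := exists_integrating_factor Td dG'.
have : normc (u t * tau t - u 0 * tau 0) <= 2 * 0 * (t - 0).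
  apply: (@complex_mean_value _ (fun x => u x * tau x) (fun=> 0) ((t + delta) / 2)).
  - by [].
  - by lra.
  - by lra.
  - move=> x xT; have xd : 0 <= x < delta by lra.
    apply: has_deriv_ext (has_derivM (du x xd) (dtau x xT)) => //.
    by ring.
  - by move=> x _; rewrite normc0.
rewrite mulr0 mul0r tau0 mulr1 => h.
have /eq0_normc/eqP : normc (u t * tau t - u 0) = 0.
  by apply/eqP; rewrite eq_le h normc_ge0.
rewrite subr_eq0 => /eqP E; apply: contraNneq u0 => ut0.
by rewrite -E ut0 mul0r.
Qed.

(** The factorisation of [F] is used twice: it makes [F] vanish at the zero sequence, which turns
    Lipschitz bounds into growth bounds, and it makes each coordinate solve a linear equation, which
    keeps it nonzero. *)
Lemma existence (R : realType) (F G : (nat -> R[i]) -> nat -> R[i])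
    (FP : (nat -> {poly R[i]}) -> nat -> {poly R[i]}) (u0 : nat -> R[i]) :
  (forall p i z, (FP p i).[z] = F (fun j => (p j).[z]) i) ->
  (forall u i, F u i = u i * G u i) ->
  (forall B, 0 <= B -> bounded_lipschitz B (fun i u => G u i)) ->
  (forall (u : R -> nat -> R[i]) t i,
     (forall j, exists l, has_deriv_on0 (fun s => u s j) t l) ->
     exists l, has_deriv_on0 (fun s => G (u s) i) t l) ->
  linfty u0 -> (forall i, u0 i != 0) ->
  exists2 delta : R, 0 < delta & exists u, is_solution F delta u0 u.
Proof.
move=> FPE FG Glip Gder u0b u0N0.
have Flip : locally_lipschitz F.
  apply: bounded_lipschitz_locally => B B0.
  have := bounded_lipschitzM (bounded_lipschitz_shift 0 B0) (Glip B B0).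
  congr bounded_lipschitz; apply/funext => i; apply/funext => u.
  by rewrite FG addn0.
have F0 i : F (fun=> 0) i = 0 by rewrite FG mul0r.
have [delta d0 [u [u_0 sol]]] := picard_local_existence FPE Flip F0 u0b.
exists delta => //; exists u; split => // t td; have [ub ud] := sol t td.
split => //; split => // i.
apply: (@linear_ode_neq0 _ (fun s => u s i) (fun s => G (u s) i) delta) => //.
- move=> s /sol[_ us]; apply: Gder => j.
  by exists (F (u s) j); exact: us.
- by move=> s /sol[_ us]; rewrite -FG; exact: us.
- by rewrite u_0.
Qed.

(** * The two Cauchy problems *)

Lemma existenceA (R : realType) (r : nat) (a0 : nat -> R[i]) :
  linfty a0 -> (forall i, a0 i != 0) ->
  exists2 delta : R, 0 < delta & exists a, is_solution (rhsA r) delta a0 a.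
Proof.
apply: (@existence _ (rhsA r) (fun a i => \prod_(1 <= j < r.+1) a (i + j)%N
    - \prod_(1 <= j < r.+1) (if (j <= i)%N then a (i - j)%N else 0))
  (fun p i => p i * (\prod_(1 <= j < r.+1) p (i + j)%N
    - \prod_(1 <= j < r.+1) (if (j <= i)%N then p (i - j)%N else 0)))).
- move=> p i z; rewrite /rhsA hornerM hornerD hornerN !horner_prod.
  congr (_ * (_ - _)); apply: eq_bigr => j _.
  by case: ifP => // _; rewrite horner0.
- by [].
- move=> B B0; apply: bounded_lipschitzD.
    by apply: bounded_lipschitz_prod => j; exact: bounded_lipschitz_shift.
  apply: bounded_lipschitzN.
  by apply: bounded_lipschitz_prod => j; exact: bounded_lipschitz_unshift.
- move=> u t i du.
  have [l hl] : exists l, has_deriv_on0 (fun s => \prod_(1 <= j < r.+1) u s (i + j)%N) t l.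
    by apply: has_deriv_prod => j; exact: du.
  have [m hm] : exists m, has_deriv_on0
      (fun s => \prod_(1 <= j < r.+1) (if (j <= i)%N then u s (i - j)%N else 0)) t m.
    apply: has_deriv_prod => j; case: (j <= i)%N; first exact: du.
    by exists 0; exact: has_deriv_cst.
  by exists (l - m); apply: has_derivD hl (has_derivN hm).
Qed.

Lemma existenceB (R : realType) (q : nat) (b0 : nat -> R[i]) :
  linfty b0 -> (forall i, b0 i != 0) ->
  exists2 delta : R, 0 < delta & exists b, is_solution (rhsB q) delta b0 b.
Proof.
apply: (@existence _ (rhsB q) (fun b i => \sum_(1 <= j < q.+1) b (i + j)%N
    - \sum_(1 <= j < q.+1) (if (j <= i)%N then b (i - j)%N else 0))
  (fun p i => p i * (\sum_(1 <= j < q.+1) p (i + j)%N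
    - \sum_(1 <= j < q.+1) (if (j <= i)%N then p (i - j)%N else 0)))).
- move=> p i z; rewrite /rhsB hornerM hornerD hornerN !horner_sum.
  congr (_ * (_ - _)); apply: eq_bigr => j _.
  by case: ifP => // _; rewrite horner0.
- by [].
- move=> B B0; apply: bounded_lipschitzD.
    by apply: bounded_lipschitz_sum => j; exact: bounded_lipschitz_shift.
  apply: bounded_lipschitzN.
  by apply: bounded_lipschitz_sum => j; exact: bounded_lipschitz_unshift.
- move=> u t i du.
  have [l hl] : exists l, has_deriv_on0 (fun s => \sum_(1 <= j < q.+1) u s (i + j)%N) t l.
    by apply: has_deriv_sum => j; exact: du.
  have [m hm] : exists m, has_deriv_on0
      (fun s => \sum_(1 <= j < q.+1) (if (j <= i)%N then u s (i - j)%N else 0)) t m.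
    apply: has_deriv_sum => j; case: (j <= i)%N; first exact: du.
    by exists 0; exact: has_deriv_cst.
  by exists (l - m); apply: has_derivD hl (has_derivN hm).
Qed.

Lemma is_solution_le (R : realType) (F : (nat -> R[i]) -> nat -> R[i])
    (delta delta' : R) (u0 : nat -> R[i]) (u : R -> nat -> R[i]) :
  delta' <= delta -> is_solution F delta u0 u -> is_solution F delta' u0 u.
Proof. by move=> dd [u_0 sol]; split => // t td; apply: sol; lra. Qed.

Theorem theorem2 (R : realType) (r q : nat) (hr : (0 < r)%N) (hq : (0 < q)%N)
    (a0 b0 : nat -> R[i]) :
  linfty a0 -> linfty b0 ->
  (forall i, a0 i != 0) -> (forall i, b0 i != 0) ->
  exists delta : R, 0 < delta /\
    (exists a, is_solution (rhsA r) delta a0 a) /\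
    (exists b, is_solution (rhsB q) delta b0 b) /\
    (forall a, is_solution (rhsA r) delta a0 a ->
       forall (i : nat) (t : R), 0 <= t < delta ->
         a t i = D1 r a0 i.+2 t * D1 r a0 i t / (D1 r a0 i.+1 t) ^+ 2) /\
    (forall b, is_solution (rhsB q) delta b0 b ->
       forall (i : nat) (t : R), 0 <= t < delta ->
         b t i = D2 q b0 (i + q).+1 t * D2 q b0 i t
                 / (D2 q b0 (i + q) t * D2 q b0 i.+1 t)).
Proof.
move=> a0b b0b a0N0 b0N0.
have [dA dA0 [a sa]] := existenceA r a0b a0N0.
have [dB dB0 [b sb]] := existenceB q b0b b0N0.
(* Only existence limits the interval: the formulas apply to every solution on it, and since their
   right-hand sides involve the initial data alone, they also give uniqueness. *)
exists (Num.min dA dB); split; first by rewrite lt_min dA0.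
split; first by exists a; apply: is_solution_le sa; rewrite ge_min lexx.
split; first by exists b; apply: is_solution_le sb; rewrite ge_min lexx orbT.
split=> [u su i t td|u su i t td]; first exact: (solutionA_formula i hr su td).
exact: (solutionB_formula i hq su td).
Qed.
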